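(* Let $A$ be a Nakayama algebra and let $S$ be a simple $A$-module with injective envelope $IS$. Then $S$ is odd or $IS$ is even. (Thus, at least one of $S$, $IS$ has finite projective dimension.)
   Context: A Nakayama algebra is an artin algebra such that all indecomposable modules are serial (i.e. have a unique composition series). Modules are left $A$-modules. An indecomposable module $M$ of finite projective dimension is called even, or odd, provided its projective dimension is an even number (including $0$), or an odd number, respectively; a module of infinite projective dimension is neither even nor odd. *)

(* Defs.v *)
From HB Require Import structures.
From mathcomp Require Import all_boot all_order all_algebra.
From mathcomp Require Import boolp classical_sets.

Set Implicit Arguments.
Unset Strict Implicit.
Unset Printing Implicit Defensive.

Import GRing.Theory.
Local Open Scope classical_set_scope.
Local Open Scope ring_scope.

Definition submodule (A : pzRingType) (M : lmodType A) (U : set M) : Prop :=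
  GRing.submod_closed [in U].

Definition nonzero_module (A : pzRingType) (M : lmodType A) : Prop :=
  exists x : M, x <> 0.

Definition simple_module (A : pzRingType) (M : lmodType A) : Prop :=
  nonzero_module M /\
  forall U : set M, submodule U -> U = [set 0] \/ U = setT.

Definition direct_sum (A : pzRingType) (M : lmodType A) (U V : set M) : Prop :=
  (forall x, exists u v, [/\ U u, V v & x = u + v]) /\ U `&` V = [set 0].

Definition indecomposable (A : pzRingType) (M : lmodType A) : Prop :=
  nonzero_module M /\
  forall U V : set M, submodule U -> submodule V -> direct_sum U V ->
    U = [set 0] \/ V = [set 0].

Definition finitely_generated (A : pzRingType) (M : lmodType A) : Prop :=
  exists (n : nat) (e : 'I_n -> M),
    forall x, exists c : 'I_n -> A, x = \sum_(i < n) c i *: e i.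

Definition artinian_module (A : pzRingType) (M : lmodType A) : Prop :=
  forall U : nat -> set M,
    (forall n, submodule (U n)) -> (forall n, U n.+1 `<=` U n) ->
    exists n, forall m, (n <= m)%N -> U m = U n.

Definition maximal_submodule_of (A : pzRingType) (M : lmodType A)
    (U V : set M) : Prop :=
  [/\ submodule U, submodule V, U `<` V &
      forall W : set M, submodule W -> U `<=` W -> W `<=` V -> W = U \/ W = V].

(* s lists the terms 0 = M_0, M_1, ..., M_n = M in increasing order. *)
Definition composition_series (A : pzRingType) (M : lmodType A)
    (s : seq (set M)) : Prop :=
  [/\ head set0 s = [set 0], last set0 s = setT &
      forall i, (i.+1 < size s)%N ->
        maximal_submodule_of (nth set0 s i) (nth set0 s i.+1)].

Definition serial (A : pzRingType) (M : lmodType A) : Prop :=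
  exists! s : seq (set M), composition_series s.

Definition artin_algebra (R : comNzRingType) (A : algType R) : Prop :=
  artinian_module (R^o : lmodType R) /\
  finitely_generated (A : lmodType R).

(* As usual for artin algebras, modules are finitely generated here. *)
Definition nakayama_algebra (R : comNzRingType) (A : algType R) : Prop :=
  artin_algebra A /\
  forall M : lmodType A, finitely_generated M -> indecomposable M -> serial M.

Definition projective_module (A : pzRingType) (P : lmodType A) : Prop :=
  forall (N N' : lmodType A) (p : {linear N -> N'}) (f : {linear P -> N'}),
    range p = setT -> exists g : {linear P -> N}, forall x, p (g x) = f x.

Definition injective_module (A : pzRingType) (I : lmodType A) : Prop :=
  forall (N' N : lmodType A) (j : {linear N' -> N}) (f : {linear N' -> I}),
    injective j -> exists g : {linear N -> I}, forall x, g (j x) = f x.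

Definition injective_envelope (A : pzRingType) (M I : lmodType A)
    (i : {linear M -> I}) : Prop :=
  [/\ injective_module I, injective i &
      forall U : set I, submodule U -> U `&` range i = [set 0] -> U = [set 0]].

Record projective_resolution (A : pzRingType) (M : lmodType A) := {
  res_mod : nat -> lmodType A;
  res_diff : forall n, {linear res_mod n.+1 -> res_mod n};
  res_aug : {linear res_mod 0%N -> M};
  res_projective : forall n, projective_module (res_mod n);
  res_aug_surj : range res_aug = setT;
  res_exact0 : range (res_diff 0%N) = [set x | res_aug x = 0];
  res_exactS : forall n,
    range (res_diff n.+1) = [set x | res_diff n x = 0]
}.

(* The resolution is 0 -> P_d -> ... -> P_0 -> M -> 0. *)
Definition resolution_length_le (A : pzRingType) (M : lmodType A)
    (P : projective_resolution M) (d : nat) : Prop :=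
  forall n, (d < n)%N -> forall x : res_mod P n, x = 0.

Definition has_projdim (A : pzRingType) (M : lmodType A) (d : nat) : Prop :=
  (exists P : projective_resolution M, resolution_length_le P d) /\
  forall (P : projective_resolution M) (e : nat),
    resolution_length_le P e -> (d <= e)%N.

Definition finite_projdim (A : pzRingType) (M : lmodType A) : Prop :=
  exists d, has_projdim M d.

Definition even_module (A : pzRingType) (M : lmodType A) : Prop :=
  indecomposable M /\ exists2 d, has_projdim M d & ~~ odd d.

Definition odd_module (A : pzRingType) (M : lmodType A) : Prop :=
  indecomposable M /\ exists2 d, has_projdim M d & odd d.

(* Main.v *)
Require Import Defs.
From HB Require Import structures.
From mathcomp Require Import all_boot all_order all_algebra.
From mathcomp Require Import boolp classical_sets.

(** An indecomposable module over a Nakayama algebra is an interval. Start with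
    an indecomposable projective Q_0 and let Q_(j+1) be the projective cover of
    the radical of Q_j, or zero when that radical vanishes. With c_j the length
    of Q_j, every quotient of Q_x is an interval [x, y) with y <= p x, where
    p x = x + c_x. The radical of Q_x is a quotient of Q_(x+1), so p is
    monotone, and the syzygy of [x, y) is [y, p x). Successive syzygies thus
    have the end points x, y, p x, p y, p (p x), ..., and the projective
    dimension is one less than the first index at which two consecutive end
    points agree ([string_projdim]).

    Choose Q_0 to be the projective cover of the injective envelope of S, and
    let z+1 be the length of that envelope. The envelope is then [0, z+1) and S,
    its socle, is [z, z+1). If the two sequences
      z, z+1, p z, p (z+1), ...   and   0, z+1, p 0, p (z+1), ...
    are compared, monotonicity shows that either the first one stops at an even
    index (S is odd), or the second one stops at an odd index (the envelope is
    even), as soon as p^k z = p^k (z+1) or p^k (z+1) = p^(k+1) 0 for some k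
    ([syz_end_parity]).

    Such a k exists ([orbit_meets]). If the string Q_0, Q_1, ... reaches zero,
    all points below its end flow into that end. Otherwise it is periodic, say
    of period n, because an indecomposable projective is determined by a
    projective cover of its radical ([common_radical_surj], where two such
    projectives are glued along their radicals and the result is serial).
    Injectivity of the envelope gives p (-1) <= z, with -1 standing for n-1
    shifted by one period ([envelope_maximal]). By pigeonhole some p^k (z+1) is,
    up to a translation by a multiple of n, of the form p^(k+1) v. If v >= 0
    then p^(k+1) 0 <= p^k (z+1), and if v <= -1 then
    p^k (z+1) <= p^(k+1) (-1) <= p^k z; the reverse inequalities always hold. *)

Set Implicit Arguments.
Unset Strict Implicit.
Unset Printing Implicit Defensive.

Import GRing.Theory.
Local Open Scope classical_set_scope.
Local Open Scope ring_scope.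

(** * Submodules and linear maps *)

Section Submodules.
Variables (A : pzRingType) (M : lmodType A).
Implicit Types U V W : set M.

Lemma submoduleP U :
  submodule U <->
  U 0 /\ forall (a : A) (x y : M), U x -> U y -> U (a *: x + y).
Proof.
split=> [[U0 Ul]|[U0 Ul]]; split.
- by move: U0; rewrite inE.
- move=> a x y Ux Uy; have := Ul a x y.
  by rewrite !inE; apply.
- by rewrite inE.
- by move=> a x y; rewrite !inE; apply: Ul.
Qed.

Lemma submod0 U : submodule U -> U 0.
Proof. by case/submoduleP. Qed.

Lemma submodZ U (a : A) (x : M) : submodule U -> U x -> U (a *: x).
Proof.
by case/submoduleP=> U0 Ul Ux; rewrite -[_ *: _]addr0; apply: Ul.
Qed.

Lemma submodD U x y : submodule U -> U x -> U y -> U (x + y).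
Proof.
by case/submoduleP=> U0 Ul Ux Uy; rewrite -[x]scale1r; apply: Ul.
Qed.

Lemma submodN U x : submodule U -> U x -> U (- x).
Proof. by move=> hU Ux; rewrite -scaleN1r; apply: submodZ. Qed.

Lemma submodB U x y : submodule U -> U x -> U y -> U (x - y).
Proof. by move=> hU Ux Uy; apply: submodD => //; apply: submodN. Qed.

Lemma submod_sum U n (F : 'I_n -> M) :
  submodule U -> (forall i, U (F i)) -> U (\sum_(i < n) F i).
Proof.
move=> hU UF; apply: (big_ind U) => //; first exact: submod0.
by move=> x y; apply: submodD.
Qed.

Lemma submodule_set0 : submodule [set 0 : M].
Proof.
by apply/submoduleP; split=> // a x y -> ->; rewrite /= scaler0 addr0.
Qed.

Lemma submoduleT : submodule (@setT M).
Proof. by apply/submoduleP. Qed.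

Lemma submoduleI U V : submodule U -> submodule V -> submodule (U `&` V).
Proof.
move=> /submoduleP[U0 Ul] /submoduleP[V0 Vl]; apply/submoduleP; split=> //.
by move=> a x y [Ux Vx] [Uy Vy]; split; [apply: Ul | apply: Vl].
Qed.

Definition submod_add U V : set M :=
  [set x | exists u v, [/\ U u, V v & x = u + v]].

Lemma submodule_add U V :
  submodule U -> submodule V -> submodule (submod_add U V).
Proof.
move=> /submoduleP[U0 Ul] /submoduleP[V0 Vl]; apply/submoduleP; split.
  by exists 0, 0; rewrite addr0.
move=> a x y [u [v [Uu Vv ->]]] [u' [v' [Uu' Vv' ->]]].
exists (a *: u + u'), (a *: v + v'); split; [exact: Ul|exact: Vl|].
by rewrite scalerDr addrACA.
Qed.

Lemma submod_addl U V : submodule V -> U `<=` submod_add U V.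
Proof. by move=> hV x Ux; exists x, 0; rewrite addr0; split=> //; apply: submod0. Qed.

Lemma submod_addr U V : submodule U -> V `<=` submod_add U V.
Proof. by move=> hU x Vx; exists 0, x; rewrite add0r; split=> //; apply: submod0. Qed.

Definition cyclic_submod (x : M) : set M := [set y | exists a : A, y = a *: x].

Lemma submodule_cyclic x : submodule (cyclic_submod x).
Proof.
apply/submoduleP; split; first by exists 0; rewrite scale0r.
by move=> a _ _ [b ->] [c ->]; exists (a * b + c); rewrite scalerDl scalerA.
Qed.

Lemma cyclic_submod_id x : cyclic_submod x x.
Proof. by exists 1; rewrite scale1r. Qed.

Lemma neq_set0 U : submodule U -> U <> [set 0] -> exists2 x, U x & x <> 0.
Proof.
move=> hU nU; apply: contrapT => H; apply: nU; apply/seteqP; split=> x /=.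
  by move=> Ux; apply: contrapT => nx; apply: H; exists x.
by move=> ->; apply: submod0.
Qed.

End Submodules.

Section Maps.
Variables (A : pzRingType) (M N : lmodType A) (f : {linear M -> N}).

Lemma submodule_image (U : set M) : submodule U -> submodule (f @` U).
Proof.
move=> /submoduleP[U0 Ul]; apply/submoduleP; split.
  by exists 0 => //; rewrite linear0.
move=> a _ _ [x Ux <-] [y Uy <-]; exists (a *: x + y); first exact: Ul.
by rewrite linearP.
Qed.

Lemma submodule_range : submodule (range f).
Proof. by apply: submodule_image; apply: submoduleT. Qed.

Lemma submodule_preimage (V : set N) : submodule V -> submodule (f @^-1` V).
Proof.
move=> /submoduleP[V0 Vl]; apply/submoduleP; split; first by rewrite /= linear0.
by move=> a x y Vx Vy; rewrite /= linearP; apply: Vl.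
Qed.

Lemma submodule_ker : submodule [set x | f x = 0].
Proof. by apply: (submodule_preimage (@submodule_set0 _ _)). Qed.

Lemma linear_inj0 : (forall x, f x = 0 -> x = 0) -> injective f.
Proof.
move=> H x y e; apply/eqP; rewrite -subr_eq0; apply/eqP/H.
by rewrite linearB /= e subrr.
Qed.

End Maps.

(** * Submodules as modules *)

Record subm (A : pzRingType) (M : lmodType A) (U : set M) (hU : submodule U) :=
  Subm { subm_val : M; subm_valP : subm_val \in U }.

Section SubmInstance.
Variables (A : pzRingType) (M : lmodType A) (U : set M) (hU : submodule U).
HB.instance Definition _ := [isSub for @subm_val A M U hU].
HB.instance Definition _ := [Choice of subm hU by <:].
HB.instance Definition _ := GRing.SubChoice_isSubLmodule.Build A M [in U]
  (subm hU) (GRing.submod_closed_semi hU).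

Definition subm_incl : {linear subm hU -> M} := \val.

Lemma subm_inclP (x : subm hU) : U (subm_incl x).
Proof. by have := subm_valP x; rewrite inE. Qed.

Lemma subm_incl_inj : injective subm_incl.
Proof. exact: val_inj. Qed.

Lemma range_subm_incl : range subm_incl = U.
Proof.
apply/seteqP; split=> [_ [x _ <-]|x Ux]; first exact: subm_inclP.
have xU : x \in U by rewrite inE.
by exists (Subm hU xU).
Qed.

Lemma subm_incl_surj x : U x -> exists y, subm_incl y = x.
Proof. by rewrite -{1}range_subm_incl => -[y _ <-]; exists y. Qed.

End SubmInstance.

Lemma factor_inj (A : pzRingType) (L M N : lmodType A) (j : {linear L -> N})
    (f : {linear M -> N}) :
  injective j -> range f `<=` range j ->
  exists g : {linear M -> L}, forall x, j (g x) = f x.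
Proof.
move=> jinj fj.
have H x : exists y, j y = f x.
  by have [|y _ <-] := fj (f x); [exists x | exists y].
have [g gP] := choice H.
have glin : linear g.
  by move=> a x y; apply: jinj; rewrite gP !linearP /= !gP.
pose gL : {linear M -> L} := HB.pack g
  (GRing.isLinear.Build A M L *:%R g glin).
by exists gL.
Qed.

Lemma factor_surj (A : pzRingType) (L M N : lmodType A) (p : {linear M -> L})
    (f : {linear M -> N}) :
  range p = setT -> (forall x, p x = 0 -> f x = 0) ->
  exists g : {linear L -> N}, forall x, g (p x) = f x.
Proof.
move=> psurj H.
have S y : exists x, p x = y.
  by have : range p y by [rewrite psurj]; case=> x _ <-; exists x.
have [s sP] := choice S.
have key x y : p x = p y -> f x = f y.
  move=> e; apply/eqP; rewrite -subr_eq0 -linearB; apply/eqP/H.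
  by rewrite linearB /= e subrr.
pose g y := f (s y).
have glin : linear g.
  by move=> a x y; rewrite /g -linearP; apply: key; rewrite linearP !sP.
pose gL : {linear L -> N} := HB.pack g
  (GRing.isLinear.Build A L N *:%R g glin).
by exists gL => x; apply: key; rewrite sP.
Qed.

Lemma projective_lift (A : pzRingType) (P N N' : lmodType A)
    (p : {linear N -> N'}) (f : {linear P -> N'}) :
  projective_module P -> range f `<=` range p ->
  exists g : {linear P -> N}, forall x, p (g x) = f x.
Proof.
move=> hP fp; have hU := submodule_range p.
have [p' p'P] : exists p' : {linear N -> subm hU},
    forall x, subm_incl hU (p' x) = p x.
  by apply: factor_inj; [exact: subm_incl_inj | rewrite range_subm_incl].
have [f' f'P] : exists f' : {linear P -> subm hU},
    forall x, subm_incl hU (f' x) = f x.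
  by apply: factor_inj; [exact: subm_incl_inj | rewrite range_subm_incl].
have p's : range p' = setT.
  apply/seteqP; split=> // y _; have [x _ e] := subm_inclP y.
  by exists x => //; apply: (@subm_incl_inj _ _ _ hU); rewrite p'P.
have [g gP] := hP _ _ p' f' p's.
by exists g => x; rewrite -p'P gP f'P.
Qed.

(** * Quotient modules *)

Section Quotient.
Variables (A : pzRingType) (M : lmodType A) (U : set M) (hU : submodule U).

(** A representative that depends only on the class of x modulo U: it is chosen
    in a set that is the same for all members of the class. *)
Definition quot_repr (x : M) : M := xget 0 [set y | U (x - y)].

Lemma quot_reprP x : U (x - quot_repr x).
Proof.
by rewrite /quot_repr; case: xgetP => [y _|/(_ x)] //=; rewrite subrr; case; apply: submod0.
Qed.

Lemma quot_repr_eq x y : U (x - y) -> quot_repr x = quot_repr y.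
Proof.
move=> xy; rewrite /quot_repr; congr xget; apply/seteqP; split=> z /= Uz.
  by rewrite -(subrK x y) -addrA -opprB addrC; apply: submodB.
by rewrite -(subrK y x) -addrA; apply: submodD.
Qed.

(** The proof h is a parameter so that the module structure, whose laws need it,
    can be found from the type alone. *)
Record quot_mod_of (h : submodule U) :=
  Quot { quot_val : M; _ : quot_repr quot_val == quot_val }.
Local Notation quot_mod := (quot_mod_of hU).

HB.instance Definition _ := [isSub for @quot_val hU].
HB.instance Definition _ := [Choice of quot_mod by <:].

Lemma quot_repr_idem x : quot_repr (quot_repr x) == quot_repr x.
Proof.
by apply/eqP/esym/quot_repr_eq/quot_reprP.
Qed.

Definition quot_class (x : M) : quot_mod := Quot hU (quot_repr_idem x).

Lemma quot_class_val (q : quot_mod) : quot_class (\val q) = q.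
Proof. by apply: val_inj; apply/eqP; case: q. Qed.

Lemma quot_class_eq x y : quot_class x = quot_class y <-> U (x - y).
Proof.
split=> [[e]|H]; last by apply: val_inj; apply: quot_repr_eq.
have := quot_reprP x; rewrite e => Ux; rewrite -(subrK (quot_repr y) x) -addrA.
by apply: submodD => //; rewrite -opprB; apply: submodN => //; apply: quot_reprP.
Qed.

Lemma quot_valK x : U (x - \val (quot_class x)).
Proof. exact: quot_reprP. Qed.

Let qadd (a b : quot_mod) := quot_class (\val a + \val b).
Let qopp (a : quot_mod) := quot_class (- \val a).
Let qscale (c : A) (a : quot_mod) := quot_class (c *: \val a).

Let qaddE x y : qadd (quot_class x) (quot_class y) = quot_class (x + y).
Proof.
apply/esym/quot_class_eq; rewrite opprD addrACA.
by apply: submodD => //; apply: quot_valK.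
Qed.

Let qoppE x : qopp (quot_class x) = quot_class (- x).
Proof.
by apply/esym/quot_class_eq; rewrite -opprD; apply: submodN => //; apply: quot_valK.
Qed.

Let qscaleE c x : qscale c (quot_class x) = quot_class (c *: x).
Proof.
by apply/esym/quot_class_eq; rewrite -scalerBr; apply: submodZ => //; apply: quot_valK.
Qed.

Let qind (P : quot_mod -> Prop) : (forall x, P (quot_class x)) -> forall q, P q.
Proof. by move=> H q; rewrite -(quot_class_val q). Qed.

Let qaddA : associative qadd.
Proof.
by elim/qind=> x; elim/qind=> y; elim/qind=> z; rewrite !qaddE addrA.
Qed.
Let qaddC : commutative qadd.
Proof. by elim/qind=> x; elim/qind=> y; rewrite !qaddE addrC. Qed.
Let qadd0 : left_id (quot_class 0) qadd.
Proof. by elim/qind=> x; rewrite !qaddE add0r. Qed.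
Let qaddN : left_inverse (quot_class 0) qopp qadd.
Proof. by elim/qind=> x; rewrite !qoppE !qaddE addNr. Qed.

HB.instance Definition _ := GRing.isZmodule.Build quot_mod qaddA qaddC qadd0 qaddN.

Let qscaleA a b v : qscale a (qscale b v) = qscale (a * b) v.
Proof. by elim/qind: v => x; rewrite !qscaleE scalerA. Qed.
Let qscale1 : left_id 1 qscale.
Proof. by elim/qind=> x; rewrite !qscaleE scale1r. Qed.
Let qscaleDr : right_distributive qscale +%R.
Proof.
by move=> a; elim/qind=> x; elim/qind=> y; rewrite /GRing.add /= qaddE !qscaleE qaddE scalerDr.
Qed.
Let qscaleDl v : {morph qscale^~ v : a b / a + b}.
Proof.
by elim/qind: v => x a b; rewrite /= [RHS]/GRing.add /= !qscaleE qaddE scalerDl.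
Qed.

HB.instance Definition _ :=
  GRing.Zmodule_isLmodule.Build A quot_mod qscaleA qscale1 qscaleDr qscaleDl.

Fact quot_class_linear : linear quot_class.
Proof.
move=> a x y; rewrite -[LHS]qaddE -qscaleE //.
Qed.
HB.instance Definition _ := GRing.isLinear.Build A M quot_mod *:%R quot_class
  quot_class_linear.

Definition quot_proj : {linear M -> quot_mod} := quot_class.

Lemma quot_proj_surj : range quot_proj = setT.
Proof. by apply/seteqP; split=> // q _; exists (\val q) => //; apply: quot_class_val. Qed.

Lemma quot_proj_eq0 x : quot_proj x = 0 <-> U x.
Proof. by rewrite -[x in U x]subr0; apply: quot_class_eq. Qed.

End Quotient.

Notation quot_mod := quot_mod_of.

(** * Uniserial modules *)

(** F j is the j-th power of the radical: the radical filtration, continued by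
    zero from j = n on. Numbering the submodules from the top makes images under
    linear maps a shift of the index, without any truncated subtraction. *)
Record uniserial (A : pzRingType) (M : lmodType A) (n : nat)
    (F : nat -> set M) : Prop := Uniserial {
  userial_sub : forall j, submodule (F j);
  userial_top : F 0%N = setT;
  userial_strict : forall j, (j < n)%N -> exists2 x, F j x & ~ F j.+1 x;
  userial_bot : forall j, (n <= j)%N -> F j = [set 0];
  userial_decr : forall j, F j.+1 `<=` F j;
  userial_all : forall U, submodule U -> exists j, U = F j }.

Section Uniserial.
Variables (A : pzRingType) (M : lmodType A) (n : nat) (F : nat -> set M).
Hypothesis uF : uniserial n F.
Implicit Types U V : set M.

Lemma userial_anti i j : (i <= j)%N -> F j `<=` F i.
Proof.
move=> /subnK <-; elim: (j - i)%N => // k IH.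
by rewrite addSn; apply: subset_trans IH; apply: (userial_decr uF).
Qed.

Lemma userial_subset i j : F j `<=` F i -> (i <= j)%N \/ (n <= j)%N.
Proof.
move=> ji; case: (leqP n j) => [|jn]; first by right.
left; rewrite leqNgt; apply/negP => lji.
have [x Fx nFx] := userial_strict uF jn.
by apply: nFx; apply: (userial_anti lji); apply: ji.
Qed.

Lemma userial_total U V : submodule U -> submodule V -> U `<=` V \/ V `<=` U.
Proof.
move=> /(userial_all uF)[i ->] /(userial_all uF)[j ->].
by case/orP: (leq_total i j) => h; [right|left]; apply: userial_anti.
Qed.

Lemma userial_eq0 j : F j `<=` [set 0] -> (n <= j)%N.
Proof.
move=> H; rewrite leqNgt; apply/negP => jn.
have [x Fx] := userial_strict uF jn; apply.
by rewrite (H _ Fx); apply: submod0; apply: (userial_sub uF).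
Qed.

Lemma userial_trivial : n = 0%N -> forall x : M, x = 0.
Proof.
by move=> n0 x; have : F 0%N x by [rewrite (userial_top uF)]; rewrite (userial_bot uF) ?n0.
Qed.

(** F j.+1 contains every proper submodule of F j, so that, as in a local
    module, an element outside it generates. *)
Lemma userial_generate j U x : submodule U -> U `<=` F j -> U x -> ~ F j.+1 x ->
  U = F j.
Proof.
move=> hU Uj Ux nx; have [i e] := userial_all uF hU.
rewrite e in Ux Uj *; apply/seteqP; split=> //; apply: userial_anti.
by rewrite leqNgt; apply/negP => /userial_anti /(_ _ Ux).
Qed.

Lemma userial_between j U : submodule U -> F j.+1 `<=` U -> U `<=` F j ->
  U = F j.+1 \/ U = F j.
Proof.
move=> hU l u; case: (pselect (U `<=` F j.+1)) => H.
  by left; apply/seteqP.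
right; move/existsNP: H => [x /not_implyP[Ux nx]].
exact: userial_generate Ux nx.
Qed.

(** Nakayama's lemma: every proper submodule V is superfluous. *)
Lemma userial_cover U V : submodule U -> submodule V ->
  (forall x, exists2 u, U u & V (x - u)) -> V <> setT -> U = setT.
Proof.
move=> hU hV UV nV; case: (userial_total hU hV) => H.
  case: nV; apply/seteqP; split=> // x _.
  by have [u Uu Vxu] := UV x; rewrite -(subrK u x); apply: submodD => //; apply: H.
apply/seteqP; split=> // x _.
by have [u Uu Vxu] := UV x; rewrite -(subrK u x); apply: submodD => //; apply: H.
Qed.

Lemma userial_neqT : (0 < n)%N -> forall j, (0 < j)%N -> F j <> setT.
Proof.
move=> n0 j j0 e; have [x _] := userial_strict uF n0; apply.
by apply: (userial_anti j0); rewrite e.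
Qed.

End Uniserial.

Section UniserialMap.
Variables (A : pzRingType) (M N : lmodType A).
Variables (m n : nat) (F : nat -> set M) (G : nat -> set N).
Hypotheses (uF : uniserial m F) (uG : uniserial n G).
Variables (f : {linear M -> N}) (k : nat).
Hypothesis fk : range f = G k.

(** By induction on j: the preimage of G (k + j).+1 is a proper submodule of
    F j, hence inside F j.+1, so the image of F j.+1 is one of two consecutive terms
    of G; it cannot be the larger one because the kernel of f is comparable with
    F j.+1. *)
Lemma userial_image j : f @` F j = G (k + j)%N.
Proof.
elim: j => [|j IH]; first by rewrite addn0 (userial_top uF) fk.
rewrite addnS; case: (leqP n (k + j)) => nkj.
  rewrite (userial_bot uG) ?(leqW nkj) //.
  apply/seteqP; split=> [_ [x Fx <-]|_ ->].
    have : (f @` F j) (f x) by exists x => //; apply: (userial_decr uF).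
    by rewrite IH (userial_bot uG).
  by exists 0; [apply: submod0; apply: (userial_sub uF)|rewrite linear0].
have hI : submodule (f @` F j.+1) by apply: submodule_image; apply: (userial_sub uF).
have [y Gy nGy] := userial_strict uG nkj.
have up : f @` F j.+1 `<=` G (k + j)%N.
  by rewrite -IH => _ [x Fx <-]; exists x => //; apply: (userial_decr uF).
have lo : G (k + j).+1 `<=` f @` F j.+1.
  pose W := f @^-1` G (k + j).+1 `&` F j.
  have hW : submodule W.
    by apply: submoduleI; [apply: submodule_preimage|]; [apply: (userial_sub uG)|apply: (userial_sub uF)].
  have [i Wi] := userial_all uF hW.
  have ji : (j < i)%N.
    rewrite ltnNge; apply/negP => ij; move: Gy; rewrite -IH => -[x Fx fx].
    have : F i x by apply: (userial_anti uF ij).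
    by rewrite -Wi => -[]; rewrite /= fx.
  move=> z Gz; have := userial_decr uG Gz; rewrite -IH => -[x Fx fx].
  exists x => //; apply: (userial_anti uF ji); rewrite -Wi; split=> //=.
  by rewrite fx.
case: (userial_between uG hI lo up) => // e; exfalso.
rewrite -IH in e.
have hK := submodule_ker f.
case: (userial_total uF hK (userial_sub uF j.+1)) => [KF|FK].
  move: Gy; rewrite -IH => -[x Fx fx]; apply: nGy; rewrite -fx.
  have FF : F j `<=` F j.+1.
    move=> u Fu; have : (f @` F j) (f u) by exists u.
    rewrite -e => -[v Fv fv]; rewrite -(subrK v u); apply: submodD => //.
      exact: (userial_sub uF).
    by apply: KF; rewrite /= linearB /= fv subrr.
  have [|/(userial_bot uF) F0] := userial_subset uF FF; first by rewrite ltnn.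
  by move: Fx; rewrite F0 => ->; rewrite linear0; apply: submod0; apply: (userial_sub uG).
move: Gy; rewrite -IH -e => -[x Fx fx]; apply: nGy; rewrite -fx.
by rewrite (FK _ Fx); apply: submod0; apply: (userial_sub uG).
Qed.

(** An index count: F i is killed exactly when its image G (k + i) is zero. *)
Lemma userial_ker : [set x | f x = 0] = F (n - k)%N.
Proof.
have [i e] := userial_all uF (submodule_ker f).
rewrite e; apply/seteqP; split.
  apply: (userial_anti uF); rewrite leq_subLR; apply: (userial_eq0 uG).
  by rewrite -userial_image -e => _ [x fx0 <-].
rewrite -e => x Fx; rewrite /=.
have : (f @` F (n - k)%N) (f x) by exists x.
by rewrite userial_image (userial_bot uG) // -leq_subLR.
Qed.

Lemma userial_length : (n <= k + m)%N.
Proof.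
apply: (userial_eq0 uG); rewrite -userial_image => _ [x Fx <-].
by move: Fx; rewrite (userial_bot uF) // => ->; rewrite linear0.
Qed.

End UniserialMap.

Lemma userial_surj_inj (A : pzRingType) (M : lmodType A) (n : nat)
    (F : nat -> set M) (h : {linear M -> M}) :
  uniserial n F -> range h = setT -> injective h.
Proof.
move=> uF hs; apply: linear_inj0 => x hx.
have e : range h = F 0%N by rewrite (userial_top uF).
have : [set x | h x = 0] x by [].
by rewrite (userial_ker uF uF e) (userial_bot uF) // subn0.
Qed.

(** * From composition series to uniserial filtrations *)

Section CompositionSeries.
Variables (A : pzRingType) (M : lmodType A).
Implicit Types (U V W : set M) (s t : seq (set M)).

Fixpoint comp_path (U : set M) (s : seq (set M)) : Prop :=
  if s is V :: s' then maximal_submodule_of U V /\ comp_path V s' else True.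

Lemma comp_path_cat U s t :
  comp_path U s -> comp_path (last U s) t -> comp_path U (s ++ t).
Proof. by elim: s U => //= V s IH U [UV sP] tP; split=> //; apply: IH. Qed.

Lemma comp_path_nth U s :
  comp_path U s <->
  forall i, (i.+1 < size (U :: s))%N ->
    maximal_submodule_of (nth set0 (U :: s) i) (nth set0 (U :: s) i.+1).
Proof.
elim: s U => [|V s IH] U; first by split=> // _ [|i].
rewrite /= -/(comp_path V s); split.
  by move=> [UV /IH H] [|i] // hi; apply: H.
by move=> H; split; [apply: (H 0%N)|apply/IH => i hi; apply: (H i.+1)].
Qed.

Lemma composition_seriesP s :
  composition_series s <->
  exists t, [/\ s = [set 0] :: t, comp_path [set 0] t & last [set 0] t = setT].
Proof.
split=> [[hd la st]|[t [-> tP la]]].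
  case: s hd la st => [|U t] /= hd la st.
    by have : [set 0 : M] 0 by []; rewrite -hd.
  by rewrite hd in la st; exists t; split=> //; [rewrite hd|apply/comp_path_nth].
by split=> //; apply/comp_path_nth.
Qed.

(** Repetitions are allowed because intersecting or adding a fixed submodule
    collapses some steps of a composition series. *)
Lemma comp_path_weak (G : nat -> set M) n :
  (forall i, (i < n)%N -> G i = G i.+1 \/ maximal_submodule_of (G i) (G i.+1)) ->
  exists2 s, comp_path (G 0%N) s & last (G 0%N) s = G n.
Proof.
elim: n => [|n IH] H; first by exists [::].
have [|s sP sl] := IH; first by move=> i ni; apply: H; apply: ltnW.
case: (H n (ltnSn n)) => [e|mx]; first by exists s; rewrite // sl.
exists (s ++ [:: G n.+1]); last by rewrite last_cat.
by apply: comp_path_cat; rewrite //= sl.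
Qed.

(** The second isomorphism theorem for a simple layer V1 / U1, which embeds the
    layer of intersections; [maximal_addl] is the dual statement. *)
Lemma maximal_capl U (U1 V1 : set M) : submodule U -> maximal_submodule_of U1 V1 ->
  U1 `&` U = V1 `&` U \/ maximal_submodule_of (U1 `&` U) (V1 `&` U).
Proof.
move=> hU [hU1 hV1 [UV1 _] mx].
have UVU : U1 `&` U `<=` V1 `&` U by move=> x [Ux xU]; split=> //; apply: UV1.
case: (pselect (V1 `&` U `<=` U1 `&` U)) => H; first by left; apply/seteqP.
right; split=> //; [exact: submoduleI|exact: submoduleI|].
move=> W hW W1 W2.
case: (mx (submod_add W U1)); first exact: submodule_add.
- exact: submod_addr.
- by move=> _ [w [u [/W2[Vw _] Uu ->]]]; apply: submodD => //; apply: UV1.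
- move=> e; left; apply/seteqP; split=> // x Wx; split; last by case: (W2 _ Wx).
  by rewrite -e; apply: submod_addl.
- move=> e; right; apply/seteqP; split=> // x [Vx Ux].
  move: Vx; rewrite -e => -[w [u [Ww Uu xwu]]]; rewrite xwu; apply: submodD => //.
  apply: W1; split=> //; have -> : u = x - w by rewrite xwu addrC addKr.
  by apply: submodB => //; case: (W2 _ Ww).
Qed.

Lemma maximal_addl U (U1 V1 : set M) : submodule U -> maximal_submodule_of U1 V1 ->
  submod_add U U1 = submod_add U V1 \/
  maximal_submodule_of (submod_add U U1) (submod_add U V1).
Proof.
move=> hU [hU1 hV1 [UV1 _] mx].
have UVU : submod_add U U1 `<=` submod_add U V1.
  by move=> _ [u [v [Uu Uv ->]]]; exists u, v; split=> //; apply: UV1.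
case: (pselect (submod_add U V1 `<=` submod_add U U1)) => H.
  by left; apply/seteqP.
right; split=> //; [exact: submodule_add|exact: submodule_add|].
move=> W hW W1 W2.
have UW : U `<=` W by move=> x Ux; apply: W1; apply: submod_addl.
case: (mx (W `&` V1)); first exact: submoduleI.
- by move=> x Ux; split; [apply: W1; apply: submod_addr|apply: UV1].
- by move=> x [].
- move=> e; left; apply/seteqP; split=> // x Wx.
  have [u [v [Uu Vv xuv]]] := W2 _ Wx.
  exists u, v; split=> //; rewrite -e; split=> //.
  have -> : v = x - u by rewrite xuv addrC addKr.
  by apply: submodB => //; apply: UW.
- move=> e; right; apply/seteqP; split=> // _ [u [v [Uu Vv ->]]].
  by apply: submodD => //; [apply: UW|move: Vv; rewrite -e => -[]].
Qed.

Lemma comp_path_submodule U s i :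
  submodule U -> comp_path U s -> submodule (nth set0 (U :: s) i) \/ (size s < i)%N.
Proof.
elim: s U i => [|V s IH] U [|i] hU /=; try by [left|right].
by move=> [[_ hV _ _] sP]; apply: IH.
Qed.

(** Every submodule is a term of some composition series: intersect a given
    series with it, add it to that series, and join the two. *)
Lemma comp_path_through U s : submodule U -> composition_series s ->
  exists t1 t2, composition_series ([set 0] :: t1 ++ t2) /\ last [set 0] t1 = U.
Proof.
move=> hU /composition_seriesP[t [_ tP tl]].
pose G i := nth set0 ([set 0] :: t) i.
have st i : (i < size t)%N -> maximal_submodule_of (G i) (G i.+1).
  by move=> it; move/comp_path_nth: tP; apply.
have Gn : G (size t) = setT by rewrite /G -tl (last_nth set0).
have [i it|t1 t1P t1l] := @comp_path_weak (fun i => G i `&` U) (size t).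
  exact: maximal_capl (st _ it).
have [i it|t2 t2P t2l] := @comp_path_weak (fun i => submod_add U (G i)) (size t).
  exact: maximal_addl (st _ it).
rewrite /= Gn setTI in t1l; rewrite /= Gn in t2l.
have e0 : [set 0] `&` U = [set 0].
  by apply/seteqP; split=> [x []//|x ->]; split=> //; apply: submod0.
rewrite /G /= e0 in t1P t1l.
have eU : submod_add U [set 0] = U.
  apply/seteqP; split=> [_ [u [_ [Uu -> ->]]]|]; first by rewrite addr0.
  by apply: submod_addl; apply: submodule_set0.
rewrite /G /= eU in t2P t2l.
exists t1, t2; split=> //; apply/composition_seriesP.
exists (t1 ++ t2); split=> //; first by apply: comp_path_cat; rewrite ?t1l.
by rewrite last_cat t1l t2l; apply/seteqP; split=> // x _; apply: submod_addr.
Qed.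

(** A submodule is a term of some composition series, and there is only one. *)
Lemma serial_uniserial : serial M -> exists n F, @uniserial A M n F.
Proof.
move=> [s [sC suniq]]; have [t [es tP tl]] := (composition_seriesP s).1 sC.
pose G i := nth set0 ([set 0] :: t) i.
have st i : (i < size t)%N -> maximal_submodule_of (G i) (G i.+1).
  by move=> it; move/comp_path_nth: tP; apply.
exists (size t), (fun j => G (size t - j)%N); split.
- move=> j; case: (@comp_path_submodule _ t (size t - j)%N (@submodule_set0 _ _) tP) => //.
  by rewrite ltnNge leq_subr.
- by rewrite /G subn0 -tl (last_nth set0).
- move=> j jt; have [|_ _ [_ /existsNP[x /not_implyP[? ?]]] _] := st (size t - j.+1)%N.
    by rewrite ltn_subrL (leq_ltn_trans _ jt).
  by exists x => //; rewrite -subnSK.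
- by move=> j; rewrite -subn_eq0 => /eqP ->.
- move=> j; rewrite subnS; case: (posnP (size t - j)) => [->//|h].
  by have [|_ _ [] ] := st (size t - j).-1; rewrite ?prednK // leq_subr.
- move=> U hU; have [t1 [t2 [t12 <-]]] := comp_path_through hU sC.
  have := suniq _ t12; rewrite es => -[ett].
  exists (size t2); rewrite /G ett size_cat addnK (last_nth set0).
  by rewrite -cat_cons nth_cat /= ltnSn.
Qed.
End CompositionSeries.

(** * Minimal projective resolutions *)
Section Comparison.
Variables (A : pzRingType) (M : lmodType A).
Variables (P Q : projective_resolution M).
(* Every image of a differential is superfluous, and surjective endomorphisms of
   the terms are injective: P is minimal with terms of finite length. *)
Hypothesis minP : forall n (U : set (res_mod P n)), submodule U ->
  (forall x, exists2 u, U u & range (res_diff P n) (x - u)) -> U = setT.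
Hypothesis surjP : forall n (h : {linear res_mod P n -> res_mod P n}),
  range h = setT -> injective h.

(* The condition on preimages under g \o f says that the bijection g \o f
   induces a bijection of the syzygies, which starts the next degree. *)
Let comparable n := exists (f : {linear res_mod P n -> res_mod Q n})
    (g : {linear res_mod Q n -> res_mod P n}),
  [/\ forall x, range (res_diff P n) x -> range (res_diff Q n) (f x),
      forall x, range (res_diff Q n) x -> range (res_diff P n) (g x),
      forall x, range (res_diff P n) (g (f x)) -> range (res_diff P n) x,
      injective (g \o f) & range (g \o f) = setT].

Let comparable0 : comparable 0.
Proof.
have [f fP] : exists f : {linear res_mod P 0 -> res_mod Q 0},
    forall x, res_aug Q (f x) = res_aug P x.
  apply: (projective_lift (@res_projective _ _ P 0)) => x _; by rewrite res_aug_surj.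
have [g gP] : exists g : {linear res_mod Q 0 -> res_mod P 0},
    forall x, res_aug P (g x) = res_aug Q x.
  apply: (projective_lift (@res_projective _ _ Q 0)) => x _; by rewrite res_aug_surj.
have rgf : range (g \o f) = setT.
  apply: minP; first exact: submodule_range.
  move=> x; exists (g (f x)); first by exists x.
  by rewrite res_exact0 /= linearB /= gP fP subrr.
exists f, g; split=> //; last exact: surjP.
- by move=> x; rewrite !res_exact0 /= fP.
- by move=> x; rewrite !res_exact0 /= gP.
- by move=> x; rewrite !res_exact0 /= gP fP.
Qed.

Let comparableS n : comparable n -> comparable n.+1.
Proof.
move=> [f [g [fr gr gfr gfi gfs]]].
have [f' f'P] : exists f' : {linear res_mod P n.+1 -> res_mod Q n.+1},
    forall x, res_diff Q n (f' x) = (f \o res_diff P n) x.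
  apply: (projective_lift (@res_projective _ _ P n.+1)).
  by move=> _ [x _ <-]; apply: fr; exists x.
have [g' g'P] : exists g' : {linear res_mod Q n.+1 -> res_mod P n.+1},
    forall x, res_diff P n (g' x) = (g \o res_diff Q n) x.
  apply: (projective_lift (@res_projective _ _ Q n.+1)).
  by move=> _ [x _ <-]; apply: gr; exists x.
have rgf : range (g' \o f') = setT.
  apply: minP; first exact: submodule_range.
  move=> x.
  have [y _ gfy] : range (g \o f) (res_diff P n x) by rewrite gfs.
  have [u _ du] : range (res_diff P n) y.
    by apply: gfr; rewrite [g _]gfy; exists x.
  exists (g' (f' u)); first by exists u.
  by rewrite res_exactS /= linearB /= g'P /= f'P /= du [g _]gfy subrr.
exists f', g'; split=> //; last exact: surjP.
- by move=> x; rewrite !res_exactS /= f'P /= => ->; rewrite linear0.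
- by move=> x; rewrite !res_exactS /= g'P /= => ->; rewrite linear0.
- move=> x; rewrite !res_exactS /= g'P /= f'P /= => e.
  by apply: gfi; rewrite /= e !linear0.
Qed.

(** Lifting the identity along P -> Q -> P gives in each degree a surjective,
    hence bijective, endomorphism of the term of P, which is therefore a direct
    summand of the term of Q. *)
Lemma minimal_resolution_zero n :
  (forall y : res_mod Q n, y = 0) -> forall x : res_mod P n, x = 0.
Proof.
have [f [g [_ _ _ gfi _]]] : comparable n by elim: n; [exact: comparable0|exact: comparableS].
by move=> Q0 x; apply: gfi; rewrite /= (Q0 (f x)) linear0 (Q0 (f 0)) linear0.
Qed.
End Comparison.

(** * Projective modules generated by an idempotent *)
Section Idempotent.
Variable A : pzRingType.
Local Notation AA := (A^o : lmodType A).

Definition left_ideal (e : A) : set AA := [set a | a * e = a].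

Fact submodule_left_ideal e : submodule (left_ideal e).
Proof.
apply/submoduleP; split; first by rewrite /left_ideal /= mul0r.
move=> a x y; rewrite /left_ideal /= => xe ye.
change ((a * x + y) * e = a * x + y).
by rewrite mulrDl -mulrA xe ye.
Qed.

Definition proj (e : A) : lmodType A := subm (submodule_left_ideal e).
Definition proj_val {e : A} : {linear proj e -> AA} :=
  subm_incl (submodule_left_ideal e).

Arguments proj_val : simpl never.

Lemma proj_valP e (x : proj e) : (proj_val x : A) * e = proj_val x.
Proof. exact: (subm_inclP (x : subm (submodule_left_ideal e))). Qed.

Lemma proj_val_inj e : injective (@proj_val e).
Proof. exact: (@subm_incl_inj _ _ _ (submodule_left_ideal e)). Qed.

Section Gen.
Variable (e : A).
Hypothesis ee : e * e = e.

Lemma proj_gen_exists : exists g : proj e, proj_val g = e.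
Proof. exact: (@subm_incl_surj A AA _ (submodule_left_ideal e) e). Qed.

Lemma proj_genE (g x : proj e) : proj_val g = e -> x = (proj_val x : A) *: g.
Proof.
move=> ge; apply: proj_val_inj; rewrite linearZ ge.
by rewrite -[LHS]proj_valP.
Qed.

(** Maps out of A e correspond to elements of e M. *)
Lemma proj_map (M : lmodType A) (m : M) (g : proj e) : proj_val g = e ->
  e *: m = m -> exists f : {linear proj e -> M}, f g = m.
Proof.
move=> ge em; pose f (x : proj e) := (proj_val x : A) *: m.
have flin : linear f by move=> a x y; rewrite /f linearP /= scalerDl scalerA.
pose fL : {linear proj e -> M} := HB.pack f
  (GRing.isLinear.Build A (proj e) M *:%R f flin).
by exists fL; rewrite /= /f ge.
Qed.

Lemma proj_projective : projective_module (proj e).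
Proof.
have [g ge] := proj_gen_exists.
have eg : e *: g = g by rewrite {2}(proj_genE g ge) ge.
move=> N N' p f ps.
have [n _ pn] : range p (f g) by rewrite ps.
have en : e *: (e *: n) = e *: n by rewrite scalerA ee.
have [h hg] := proj_map ge en.
exists h => x; rewrite (proj_genE x ge) !linearZ /= hg linearZ /= pn -linearZ /= eg //.
Qed.

Lemma proj_fg : finitely_generated (proj e).
Proof.
have [g ge] := proj_gen_exists.
exists 1%N, (fun=> g) => x; exists (fun=> proj_val x).
by rewrite big_ord_recl big_ord0 addr0; apply: proj_genE.
Qed.

End Gen.

End Idempotent.

(** * Chain condition and decomposition of the unit *)

Section FgArtinian.
Variables (R : comNzRingType) (M : lmodType R).

(** Induction on the span of the first j generators: the leading coefficients,
    at the j-th generator, of the members of U k form a descending chain of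
    ideals. Once it is stationary, an element of U N in the span of j+1
    generators differs from one of U k by an element of the span of j. *)
Lemma fg_artinian : artinian_module (R^o : lmodType R) -> finitely_generated M ->
  artinian_module M.
Proof.
move=> hR [n [e he]] U hU dU.
have dec i j : (i <= j)%N -> U j `<=` U i.
  move=> /subnK <-; elim: (j - i)%N => // k IH.
  by rewrite addSn; apply: subset_trans IH; apply: dU.
pose sp j : set M := [set x | exists c : 'I_n -> R,
  (forall i : 'I_n, (j <= i)%N -> c i = 0) /\ x = \sum_(i < n) c i *: e i].
have sp_sub j : submodule (sp j).
  apply/submoduleP; split.
    by exists (fun=> 0); split=> //; rewrite big1 // => i _; rewrite scale0r.
  move=> a x y [c [c0 ->]] [d [d0 ->]].
  exists (fun i => a * c i + d i); split.
    by move=> i ij; rewrite c0 // d0 // mulr0 addr0.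
  rewrite scaler_sumr -big_split /=; apply: eq_bigr => i _.
  by rewrite scalerDl scalerA.
have sp_step (j : 'I_n) x : sp j.+1 x -> exists (r : R) y, sp j y /\ x = r *: e j + y.
  move=> [c [c0 ->]]; exists (c j), (\sum_(i < n) (if i == j then 0 else c i) *: e i).
  split.
    exists (fun i => if i == j then 0 else c i); split=> // i ji.
    case: eqVneq => // nij; apply: c0; rewrite ltn_neqAle ji andbT.
    by rewrite eq_sym.
  rewrite (bigD1 j) //= [in RHS](bigD1 j) //= eqxx scale0r add0r; congr (_ + _).
  by apply: eq_bigr => i /negbTE ->.
pose J k (j : 'I_n) : set R^o := [set r | exists y, sp j y /\ U k ((r : R) *: e j + y)].
have J_sub k j : submodule (J k j).
  apply/submoduleP; split.
    exists 0; rewrite scale0r addr0.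
    by split; apply: submod0.
  move=> a r r' [y [Sy Uy]] [y' [Sy' Uy']]; exists (a *: y + y').
  split; first by have /submoduleP[_] := sp_sub j; apply.
  have /submoduleP[_ /(_ a _ _ Uy Uy')] := hU k.
  by rewrite scalerDr addrACA scalerA -scalerDl.
have J_dec j k : J k.+1 j `<=` J k j.
  by move=> r [y [Sy Uy]]; exists y; split=> //; apply: dU.
have key j : (j <= n)%N -> exists N, forall k, (N <= k)%N ->
    forall x, sp j x -> U N x -> U k x.
  elim: j => [_|j IH jn].
    exists 0%N => k _ x [c [c0 ->]] _.
    by rewrite big1 => [|i _]; [apply: submod0|rewrite c0 // scale0r].
  have [N1 N1P] := IH (ltnW jn).
  have [N2 N2P] := hR (J^~ (Ordinal jn)) (J_sub^~ _) (J_dec _).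
  exists (maxn N1 N2) => k; rewrite geq_max => /andP[k1 k2] x Sx Ux.
  have [r [y [Sy xry]]] := @sp_step (Ordinal jn) x Sx.
  have : J (maxn N1 N2) (Ordinal jn) r by exists y; rewrite -xry.
  rewrite N2P ?leq_maxr // -(N2P k) // => -[y' [Sy' Uy']].
  rewrite -(subrK (r *: e (Ordinal jn) + y') x); apply: submodD => //.
  apply: N1P => //.
    rewrite xry opprD addrACA subrr add0r.
    exact: submodB.
  apply: (dec _ _ (leq_maxl N1 N2)); apply: submodB => //.
  by apply: (dec _ k) => //; rewrite geq_max k1.
have [N NP] := key n (leqnn n).
exists N => k Nk; apply/seteqP; split; first exact: dec.
move=> x Ux; apply: (NP k) => //.
have [c xc] := he x; exists c; split=> // i; by rewrite leqNgt ltn_ord.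
Qed.
End FgArtinian.

Lemma artin_algebra_artinian (R : comNzRingType) (A : algType R) :
  artin_algebra A -> artinian_module (A^o : lmodType A).
Proof.
move=> [hR hA] U hU dU; have := @fg_artinian R A hR hA U; apply=> // n.
apply/submoduleP; split; first exact: (submod0 (hU n)).
move=> a x y Ux Uy; rewrite -[x]mul1r scalerAl.
by have /submoduleP[_ /(_ (a *: 1) x y Ux Uy)] := hU n.
Qed.

Lemma artinian_min (A : pzRingType) (M : lmodType A) (T : set (set M)) U0 :
  artinian_module M -> (forall U, T U -> submodule U) -> T U0 ->
  exists2 U, T U & forall V, T V -> V `<=` U -> V = U.
Proof.
move=> hM Ts T0; apply: contrapT => H.
have step (U : {U | T U}) : exists V : {U | T U}, sval V `<` sval U.
  case: U => U TU /=; apply: contrapT => H'; apply: H; exists U => // V TV VU.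
  apply/seteqP; split=> //; apply: contrapT => nUV; apply: H'.
  by exists (exist _ V TV).
have [g gP] := choice step.
pose c n := iter n g (exist _ U0 T0).
have [n|n|n /(_ n.+1 (leqnSn n)) e] := hM (fun n => sval (c n)).
- by apply: Ts; case: (c n).
- by have [] := gP (c n).
- by have [_] := gP (c n); apply; rewrite -[g _]/(c n.+1) e.
Qed.

Definition primitive_idem (A : pzRingType) (e : A) : Prop :=
  e * e = e /\ indecomposable (proj e).

Section Decomposition.
Variable A : pzRingType.
Hypothesis artA : artinian_module (A^o : lmodType A).

(* The two components of e in a decomposition of A e are orthogonal
   idempotents. *)
Let split_idem (e : A) : e * e = e -> e <> 0 -> ~ indecomposable (proj e) ->
  exists a b : A, [/\ [/\ e = a + b, a * a = a & b * b = b],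
    a * e = a, b * e = b, e * a <> e & e * b <> e].
Proof.
move=> ee e0 ni; have [g ge] := proj_gen_exists ee.
have nz : nonzero_module (proj e).
  by exists g => g0; apply: e0; rewrite -ge g0 linear0.
have [U [V [hU hV [UV UV0] nU nV]]] : exists U V : set (proj e),
    [/\ submodule U, submodule V, direct_sum U V, U <> [set 0] & V <> [set 0]].
  apply: contrapT => H; apply: ni; split=> // U V hU hV d.
  case: (pselect (U = [set 0])) => nU; [by left|right].
  by apply: contrapT => nV; apply: H; exists U, V.
have [u [v [Uu Vv guv]]] := UV g.
pose a : A := proj_val u; pose b : A := proj_val v.
have eab : e = a + b by rewrite -ge guv linearD.
have cap x : U x -> V x -> x = 0.
  by move=> Ux Vx; have : (U `&` V) x by []; rewrite UV0.
have ug : u = a *: g := proj_genE u ge.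
have vg : v = b *: g := proj_genE v ge.
have av : a *: v = 0.
  apply: cap; last exact: submodZ.
  have -> : a *: v = u - a *: u.
    by rewrite {1}ug guv scalerDr addrC addKr.
  by apply: submodB => //; apply: submodZ.
have bu : b *: u = 0.
  apply: cap; first exact: submodZ.
  have -> : b *: u = v - b *: v.
    by rewrite {1}vg guv scalerDr addrK.
  by apply: submodB => //; apply: submodZ.
have ba : b * a = 0.
  by have := congr1 (@proj_val _ e) bu; rewrite linearZ linear0.
have ab : a * b = 0.
  by have := congr1 (@proj_val _ e) av; rewrite linearZ linear0.
have ae : a * e = a := proj_valP u.
have be : b * e = b := proj_valP v.
have aa : a * a = a by rewrite -[RHS]ae eab mulrDr ab addr0.
have bb : b * b = b by rewrite -[RHS]be eab mulrDr ba add0r.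
exists a, b; split=> //.
- rewrite eab mulrDl ba addr0 aa => eb; apply: nV; apply/seteqP; split=> [y Vy|_ ->]; last exact: submod0.
  have b0 : b = 0 by apply: (addrI a); rewrite -eb addr0.
  have v0 : v = 0 by apply: proj_val_inj; rewrite linear0.
  apply: cap => //; rewrite (proj_genE y ge) guv v0 addr0.
  exact: submodZ.
- rewrite eab mulrDl ab add0r bb => ea; apply: nU; apply/seteqP; split=> [y Uy|_ ->]; last exact: submod0.
  have a0 : a = 0 by apply: (addIr b); rewrite -ea add0r.
  have u0 : u = 0 by apply: proj_val_inj; rewrite linear0.
  apply: cap => //; rewrite (proj_genE y ge) guv u0 add0r.
  exact: submodZ.
Qed.

(** A bad idempotent with A e minimal splits as a sum of two idempotents which
    generate smaller left ideals and hence are good. *)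
Lemma idem_decomposition (e : A) : e * e = e ->
  exists n (f : 'I_n -> A), (forall i, primitive_idem (f i)) /\ e = \sum_(i < n) f i.
Proof.
move=> ee; apply: contrapT => bad.
pose good (x : A) := exists n (f : 'I_n -> A),
  (forall i, primitive_idem (f i)) /\ x = \sum_(i < n) f i.
pose T : set (set A^o) := [set U | exists x : A,
  [/\ x * x = x, ~ good x & U = left_ideal x]].
have [U [x [xx nx ->]] xmin] : exists2 U, T U & forall V, T V -> V `<=` U -> V = U.
  apply: (@artinian_min _ _ T (left_ideal e)) => //; last by exists e.
  by move=> U [x [_ _ ->]]; apply: submodule_left_ideal.
have x0 : x <> 0.
  move=> x0; apply: nx; exists 0%N, (fun=> 0); rewrite big_ord0; split=> //.
  by case.
have nix : ~ indecomposable (proj x).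
  move=> ix; apply: nx; exists 1%N, (fun=> x); split=> //.
  by rewrite big_ord_recl big_ord0 addr0.
have [a [b [[xab aa bb] ax bx xa xb]]] := split_idem xx x0 nix.
have sm y : y * y = y -> y * x = y -> x * y <> x -> good y.
  move=> yy yx nxy; apply: contrapT => ny; apply: nxy.
  have e1 : left_ideal y = left_ideal x.
    apply: xmin; first by exists y.
    by move=> z /= <-; rewrite /left_ideal /= -mulrA yx.
  by have : left_ideal x x by []; rewrite -e1.
have [n [f [fP af]]] := sm a aa ax xa.
have [m [h [hP bh]]] := sm b bb bx xb.
apply: nx; exists (n + m)%N, (fun i => match split i with inl i => f i | inr i => h i end).
split; first by move=> i; case: split.
rewrite xab af bh big_split_ord /=; congr (_ + _); apply: eq_bigr => i _.
  by rewrite (unsplitK (inl i : 'I_n + 'I_m)).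
by rewrite (unsplitK (inr i : 'I_n + 'I_m)).
Qed.

End Decomposition.

(** * Modules over Nakayama algebras *)

Section FiniteGeneration.
Variables (A : pzRingType) (M : lmodType A).
Implicit Types U V : set M.

Definition fg_sub U : Prop := exists n (x : 'I_n -> M),
  forall y, U y <-> exists c : 'I_n -> A, y = \sum_(i < n) c i *: x i.

Lemma fg_subT : fg_sub setT <-> finitely_generated M.
Proof.
by split=> [] [n [x H]]; exists n, x => y; [apply/H|split=> // _; apply: H].
Qed.

Lemma fg_sub_subm U (hU : submodule U) : fg_sub U -> finitely_generated (subm hU).
Proof.
move=> [n [x H]].
have xU i : exists y : subm hU, subm_incl hU y = x i.
  apply: subm_incl_surj; apply/H; exists (fun j => (j == i)%:R).
  rewrite (bigD1 i) //= eqxx scale1r big1 ?addr0 // => j /negbTE ->.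
  by rewrite scale0r.
have [z zP] := choice xU; exists n, z => y.
have [c yc] := (H _).1 (subm_inclP y); exists c; apply: (@subm_incl_inj _ _ _ hU).
by rewrite yc linear_sum; apply: eq_bigr => i _; rewrite -zP linearZ.
Qed.

Lemma fg_sub_cyclic x : fg_sub (cyclic_submod x).
Proof.
exists 1%N, (fun=> x) => y; split=> [[a ->]|[c ->]].
  by exists (fun=> a); rewrite big_ord_recl big_ord0 addr0.
by rewrite big_ord_recl big_ord0 addr0; exists (c ord0).
Qed.

Lemma fg_sub_add U V : fg_sub U -> fg_sub V -> fg_sub (submod_add U V).
Proof.
move=> [n [x HU]] [m [y HV]].
exists (n + m)%N, (fun i => match split i with inl j => x j | inr j => y j end) => z.
have sumE (c : 'I_(n + m) -> A) : \sum_(i < n + m) c i *: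
      match split i with inl j => x j | inr j => y j end =
    \sum_(i < n) c (lshift m i) *: x i + \sum_(i < m) c (rshift n i) *: y i.
  rewrite big_split_ord /=; congr (_ + _); apply: eq_bigr => i _.
    by rewrite (unsplitK (inl i : 'I_n + 'I_m)).
  by rewrite (unsplitK (inr i : 'I_n + 'I_m)).
split=> [[u [v [/HU[c ->] /HV[d ->] ->]]]|[c ->]].
  exists (fun i => match split i with inl j => c j | inr j => d j end).
  rewrite sumE; congr (_ + _); apply: eq_bigr => i _.
    by rewrite (unsplitK (inl i : 'I_n + 'I_m)).
  by rewrite (unsplitK (inr i : 'I_n + 'I_m)).
rewrite sumE; do 2![eexists]; split; last by [].
  by apply/HU; eexists.
by apply/HV; eexists.
Qed.

End FiniteGeneration.

Lemma fg_sub_range (A : pzRingType) (M N : lmodType A) (f : {linear M -> N}) :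
  finitely_generated M -> fg_sub (range f).
Proof.
move=> [n [x H]]; exists n, (f \o x) => y; split=> [[z _ <-]|[c ->]].
  have [c ->] := H z; exists c; rewrite linear_sum /=.
  by apply: eq_bigr => i _; rewrite linearZ.
exists (\sum_(i < n) c i *: x i) => //; rewrite linear_sum /=.
by apply: eq_bigr => i _; rewrite linearZ.
Qed.

Lemma uniform_indecomposable (A : pzRingType) (M : lmodType A) :
  nonzero_module M ->
  (forall U V : set M, submodule U -> submodule V ->
     U <> [set 0] -> V <> [set 0] -> U `&` V <> [set 0]) ->
  indecomposable M.
Proof.
move=> nz H; split=> // U V hU hV [_ UV0].
case: (pselect (U = [set 0])) => nU; [by left|right].
by apply: contrapT => nV; apply: (H U V).
Qed.

Lemma simple_indecomposable (A : pzRingType) (M : lmodType A) :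
  simple_module M -> indecomposable M.
Proof.
move=> [nz H]; apply: uniform_indecomposable => // U V hU hV nU nV.
have [//|->] := H U hU; have [//|->] := H V hV.
rewrite setTI => e; case: nz => x; apply.
by have : (@setT M) x by []; rewrite e.
Qed.

(** * Amalgamation *)

Section Pushout.
Variables (A : pzRingType) (N M1 M2 : lmodType A).
Variables (p1 : {linear N -> M1}) (p2 : {linear N -> M2}).

Lemma pushout : exists (E : lmodType A) (f1 : {linear M1 -> E}) (f2 : {linear M2 -> E}),
  (forall w, exists x y, w = f1 x + f2 y) /\
  (forall x y, f1 x + f2 y = 0 <-> exists t, x = p1 t /\ y = - p2 t).
Proof.
pose P : lmodType A := (M1 * M2)%type.
pose K : set P := [set z | exists t, z.1 = p1 t /\ z.2 = - p2 t].
have hK : submodule K.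
  apply/submoduleP; split; first by exists 0; rewrite !linear0.
  move=> a z z' [t [h1 h2]] [t' [h1' h2']]; exists (a *: t + t').
  by rewrite !linearP /= h1 h2 h1' h2'.
pose q := quot_proj hK.
have l1 : linear (fun x : M1 => q ((x, 0) : P)).
  move=> a x y; rewrite -linearP; congr (q _); apply: injective_projections => //=.
  by rewrite scaler0 addr0.
have l2 : linear (fun x : M2 => q ((0, x) : P)).
  move=> a x y; rewrite -linearP; congr (q _); apply: injective_projections => //=.
  by rewrite scaler0 addr0.
pose f1 : {linear M1 -> quot_mod hK} := HB.pack (fun x : M1 => q ((x, 0) : P))
  (GRing.isLinear.Build A M1 (quot_mod hK) *:%R _ l1).
pose f2 : {linear M2 -> quot_mod hK} := HB.pack (fun x : M2 => q ((0, x) : P))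
  (GRing.isLinear.Build A M2 (quot_mod hK) *:%R _ l2).
have fE x y : f1 x + f2 y = q ((x, y) : P).
  rewrite /f1 /f2 /= -linearD; congr (q _); apply: injective_projections => /=.
    by rewrite addr0.
  by rewrite add0r.
exists (quot_mod hK), f1, f2; split=> [w|x y].
  have : range q w by rewrite quot_proj_surj.
  by case=> -[x y] _ <-; exists x, y; rewrite fE.
by rewrite fE; apply: quot_proj_eq0.
Qed.
End Pushout.

Section Nakayama.
Variable A : nzRingType.
Hypothesis serialA :
  forall M : lmodType A, finitely_generated M -> indecomposable M -> serial M.

Lemma nakayama_uniserial (M : lmodType A) :
  finitely_generated M -> indecomposable M ->
  exists n F, (0 < n)%N /\ @uniserial A M n F.
Proof.
move=> fM iM; have [n [F uF]] := serial_uniserial (serialA fM iM).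
exists n, F; split=> //; rewrite lt0n; apply/eqP => n0.
by case: iM => -[x nx] _; apply: nx; apply: (userial_trivial uF n0).
Qed.

(** If the radicals of A e and of M2 are nonzero quotients of the uniserial
    module N, then M2 is an image of A e. Let E be the amalgam of the two modules
    over N. A nonzero submodule W of E that misses the image U1 of A e also
    misses the image of M2, so it projects injectively to both simple tops; an
    element of W then gives a map from A e onto M2. Without such a map every W
    meets U1, so E is uniform, hence uniserial, and one of the two images lies
    inside the other, which forces a module to equal its radical. *)
Lemma common_radical_surj (N M2 : lmodType A) (e : A) n0 F0 n1 F1 n2 F2
    (p1 : {linear N -> proj e}) (p2 : {linear N -> M2}) :
  e * e = e -> @uniserial A N n0 F0 -> @uniserial A (proj e) n1 F1 ->
  @uniserial A M2 n2 F2 -> finitely_generated M2 ->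
  (1 < n1)%N -> (1 < n2)%N -> range p1 = F1 1%N -> range p2 = F2 1%N ->
  exists f : {linear proj e -> M2}, range f = setT.
Proof.
move=> ee u0 u1 u2 fg2 n1g n2g r1 r2; apply: contrapT => nosurj.
have [E [f1 [f2 [fE f0]]]] := pushout p1 p2.
have comm t : f1 (p1 t) = f2 (p2 t).
  apply/eqP; rewrite -subr_eq0 -linearN; apply/eqP/f0; by exists t.
have f1_0 x : f1 x = 0 -> F1 1%N x.
  move=> fx; have [t [-> _]] : exists t, x = p1 t /\ 0 = - p2 t.
    by apply/f0; rewrite fx linear0 addr0.
  by rewrite -r1; exists t.
have [t0 ht0] : exists t, f1 (p1 t) <> 0.
  apply: contrapT => H.
  have H' t : exists t', p1 t = p1 t' /\ p2 t' = 0.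
    have [t' [h1 h2]] : exists t', p1 t = p1 t' /\ 0 = - p2 t'.
      apply/f0; rewrite linear0 addr0; apply: contrapT => nt; apply: H; by exists t.
    by exists t'; split=> //; apply/eqP; rewrite -oppr_eq0 -h2.
  have nt1 := userial_strict u1 n1g; have nt2 := userial_strict u2 n2g.
  have [x1 F1x nF1x] := nt1; have [x2 F2x nF2x] := nt2.
  (* the kernels of p1 and p2 would span N, but one contains the other *)
  case: (userial_total u0 (submodule_ker p1) (submodule_ker p2)) => kk.
    move: F2x; rewrite -r2 => -[t _ tx]; apply: nF2x.
    have [t' [h1 h2]] := H' t.
    have /= : [set x | p2 x = 0] (t - t') by apply: kk; rewrite /= linearB /= h1 subrr.
    rewrite linearB /= h2 subr0 tx => ->.
    by apply: submod0; apply: (userial_sub u2).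
  move: F1x; rewrite -r1 => -[t _ tx]; apply: nF1x.
  have [t' [h1 h2]] := H' t; rewrite -tx h1 (kk t' h2).
  by apply: submod0; apply: (userial_sub u1).
pose U1 := range f1; pose U2 := range f2.
have hU1 : submodule U1 := submodule_range f1.
have hU2 : submodule U2 := submodule_range f2.
have chain (L : lmodType A) n F (f : {linear L -> E}) (V W : set E) :
    @uniserial A L n F -> submodule V -> submodule W ->
    V `<=` range f -> W `<=` range f -> V `<=` W \/ W `<=` V.
  move=> u hV hW Vf Wf.
  have [H|H] := userial_total u (submodule_preimage f hV) (submodule_preimage f hW).
    by left=> y Vy; have [x _ fx] := Vf _ Vy; rewrite -fx; apply: H; rewrite /= fx.
  by right=> y Wy; have [x _ fx] := Wf _ Wy; rewrite -fx; apply: H; rewrite /= fx.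
have nF1T : F1 1%N <> setT by apply: (userial_neqT u1) => //; apply: ltnW.
have nF2T : F2 1%N <> setT by apply: (userial_neqT u2) => //; apply: ltnW.
have meetU1 W : submodule W -> W <> [set 0] -> W `&` U1 <> [set 0].
  move=> hW nW W1.
  have W1' z : W z -> U1 z -> z = 0.
    by move=> Wz Uz; have : (W `&` U1) z by []; rewrite W1.
  have W2' z : W z -> U2 z -> z = 0.
    move=> Wz Uz; pose H := range (f1 \o p1).
    have hH : submodule H := submodule_range _.
    have hW2 := submoduleI hW hU2.
    have HU2 : H `<=` U2 by move=> _ [t _ <-]; exists (p2 t); rewrite //= comm.
    have HU1 : H `<=` U1 by move=> _ [t _ <-]; exists (p1 t).
    have WU2 : W `&` U2 `<=` U2 by move=> x [].
    have [WH|HW] := chain _ _ _ f2 _ _ u2 hW2 hH WU2 HU2.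
      by apply: W1' => //; apply: HU1; apply: WH.
    have [|Wt _] := HW (f1 (p1 t0)); first by exists t0.
    by case: ht0; apply: W1' => //; exists (p1 t0).
  have [w Ww w0] := neq_set0 hW nW.
  have [x [y wxy]] := fE w.
  have nx : ~ F1 1%N x.
    rewrite -r1 => -[t _ tx]; apply: w0; apply: W2' => //.
    by exists (p2 t + y); rewrite // linearD /= -comm tx.
  (* x generates A e, so a multiple of w has first component e *)
  have cyx : cyclic_submod x = setT.
    rewrite -(userial_top u1); apply: (userial_generate u1 (submodule_cyclic x)) nx.
      by rewrite (userial_top u1).
    exact: cyclic_submod_id.
  have [g ge] := proj_gen_exists ee.
  have [a ga] : cyclic_submod x g by rewrite cyx.
  have eg : e *: g = g by rewrite [in RHS](proj_genE g ge) ge.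
  pose y1 := e *: (a *: y).
  have Wg : W (f1 g + f2 y1).
    have -> : f1 g + f2 y1 = e *: (a *: w).
      by rewrite wxy !scalerDr -!linearZ /= -ga eg.
    by do 2!apply: submodZ => //.
  have ny : ~ F2 1%N y1.
    rewrite -r2 => -[t _ ty]; apply: nF1T.
    rewrite -ty -comm -linearD in Wg.
    have : F1 1%N g.
      have : F1 1%N (g + p1 t) by apply: f1_0; apply: W1' => //; exists (g + p1 t).
      rewrite -{2}(addrK (p1 t) g) => h; apply: submodB => //.
        exact: (userial_sub u1).
      by rewrite -r1; exists t.
    move=> Fg; apply/seteqP; split=> // z _; rewrite (proj_genE z ge).
    by apply: submodZ => //; apply: (userial_sub u1).
  have ey : e *: y1 = y1 by rewrite scalerA ee.
  have [f fg] := proj_map ge ey; apply: nosurj; exists f.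
  rewrite -(userial_top u2); apply: (userial_generate u2 (submodule_range f)) ny.
    by rewrite (userial_top u2).
  by exists g.
have nzE : nonzero_module E by exists (f1 (p1 t0)).
have indE : indecomposable E.
  apply: uniform_indecomposable => // V W hV hW nV nW VW.
  have VV := meetU1 _ hV nV; have WW := meetU1 _ hW nW.
  have hVU := submoduleI hV hU1; have hWU := submoduleI hW hU1.
  have sub x : V x -> W x -> x = 0.
    by move=> Vx Wx; have : (V `&` W) x by []; rewrite VW.
  have [H|H] := chain _ _ _ f1 _ _ u1 hVU hWU (@subIsetr _ _ _) (@subIsetr _ _ _).
    have [x [Vx Ux] x0] := neq_set0 hVU VV; apply: x0; apply: sub => //.
    by have [] : (W `&` U1) x by apply: H.
  have [x [Wx Ux] x0] := neq_set0 hWU WW; apply: x0; apply: sub => //.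
  by have [] : (V `&` U1) x by apply: H.
have fgE : finitely_generated E.
  apply/fg_subT; have <- : submod_add U1 U2 = setT.
    apply/seteqP; split=> // w _; have [x [y ->]] := fE w.
    by exists (f1 x), (f2 y); split=> //; [exists x|exists y].
  by apply: fg_sub_add; apply: fg_sub_range => //; apply: proj_fg.
have [n [F [_ uE]]] := nakayama_uniserial fgE indE.
have [H|H] := userial_total uE hU1 hU2.
  apply: nF1T; apply/seteqP; split=> // x _.
  have [y _ fy] : U2 (f1 x) by apply: H; exists x.
  have [t [-> _]] : exists t, x = p1 t /\ - y = - p2 t.
    by apply/f0; rewrite linearN /= fy subrr.
  by rewrite -r1; exists t.
apply: nF2T; apply/seteqP; split=> // y _.
have [x _ fx] : U1 (f2 y) by apply: H; exists y.
have [t [_ yt]] : exists t, - x = p1 t /\ y = - p2 t.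
  by apply/f0; rewrite linearN /= fx addrC subrr.
by rewrite -r2; exists (- t); rewrite ?linearN.
Qed.

End Nakayama.

Section BasicProjectives.
Variable A : nzRingType.
Hypothesis serialA :
  forall M : lmodType A, finitely_generated M -> indecomposable M -> serial M.
Hypothesis artA : artinian_module (A^o : lmodType A).

(** The family supplies projective covers for all nonzero submodules of uniserial
    modules; surjectivity suffices, because lengths determine the kernels. *)
Definition covering m (e : 'I_m -> A) : Prop :=
  forall (M : lmodType A) n F, @uniserial A M n F -> forall j, (j < n)%N ->
  exists v (f : {linear proj (e v) -> M}), range f = F j.

(** If x generates F j, then so does some component e v *: x, because the e v
    sum to 1. *)
Lemma covering_exists : exists m (e : 'I_m -> A),
  (forall v, primitive_idem (e v)) /\ covering e.
Proof.
have [m [e [eP e1]]] := idem_decomposition artA (mulr1 1).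
exists m, e; split=> // M n F uF j jn.
have [x Fx nFx] := userial_strict uF jn.
have [v nv] : exists v, ~ F j.+1 (e v *: x).
  apply: contrapT => H; apply: nFx; rewrite -[x]scale1r e1 scaler_suml.
  apply: submod_sum => [|v]; first exact: (userial_sub uF).
  by apply: contrapT => nv; apply: H; exists v.
have [g ge] := proj_gen_exists (eP v).1.
have ex : e v *: (e v *: x) = e v *: x by rewrite scalerA (eP v).1.
have [f fg] := proj_map ge ex.
exists v, f; apply: (userial_generate uF (submodule_range f) _ _ nv); last by exists g.
move=> _ [y _ <-]; rewrite (proj_genE y ge) linearZ /= fg.
by do 2!(apply: submodZ; first exact: (userial_sub uF)).
Qed.

(** A covering family of least size has no repetitions up to isomorphism. *)
Lemma basic_projectives : exists m (e : 'I_m -> A),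
  [/\ forall v, primitive_idem (e v), covering e &
      forall v w (f : {linear proj (e v) -> proj (e w)}), range f = setT -> v = w].
Proof.
pose Q m := `[< exists e : 'I_m -> A, (forall v, primitive_idem (e v)) /\ covering e >].
have exQ : exists m, Q m.
  by have [m [e H]] := covering_exists; exists m; apply/asboolP; exists e.
have [m /asboolP[e [eP ce]] mmin] := ex_minnP exQ.
exists m, e; split=> // v w f fs; apply: contrapT => vw.
(* if e w is an image of e v, then e w can be dropped *)
case: m e eP ce mmin v w f fs vw => [|m] e eP ce mmin v w f fs vw.
  by have := ltn_ord v.
suff : (m.+1 <= m)%N by rewrite ltnn.
apply: mmin; apply/asboolP; exists (fun i => e (lift w i)); split=> // M n F uF j jn.
have [u [h hr]] := ce M n F uF j jn.
case: (unliftP w u) => [u' eu|eu]; first by rewrite eu in h hr; exists u', h.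
have [v' ev] : exists v', v = lift w v'.
  by case: (unliftP w v) => [v' ->|//]; exists v'.
rewrite ev in f fs; rewrite eu in h hr; exists v', (h \o f).
rewrite -hr; apply/seteqP; split=> [_ [x _ <-]|_ [y _ <-]]; first by exists (f x).
have : range f y by rewrite fs.
by case=> x _ <-; exists x.
Qed.

End BasicProjectives.

(** * Injective envelopes of simple modules *)

Section Envelope.
Variable A : nzRingType.
Hypothesis serialA :
  forall M : lmodType A, finitely_generated M -> indecomposable M -> serial M.
Variables (S I : lmodType A) (i : {linear S -> I}).
Hypotheses (hS : simple_module S) (hI : injective_envelope i).

Lemma envelope_essential (U : set I) : submodule U -> U <> [set 0] -> range i `<=` U.
Proof.
case: hI => _ iinj ess hU nU; have hr := submodule_range i.
have [x [Ux [s _ sx]] x0] := neq_set0 (submoduleI hU hr) (fun e => nU (ess _ hU e)).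
case: hS => _ /(_ _ (submodule_preimage i hU)) [e|e].
  have : (i @^-1` U) s by rewrite /= sx.
  by rewrite e => s0; case: x0; rewrite -sx s0 linear0.
move=> _ [y _ <-]; have : @setT S y by [].
by rewrite -e.
Qed.

Lemma envelope_nonzero : exists2 x, range i x & x <> 0.
Proof.
case: hS => -[s s0] _; exists (i s); first by exists s.
move=> is0; apply: s0; case: hI => _ iinj _; apply: iinj.
by rewrite is0 linear0.
Qed.

Lemma envelope_sub_indecomposable (U : set I) (hU : submodule U) :
  U <> [set 0] -> indecomposable (subm hU).
Proof.
move=> nU; apply: uniform_indecomposable.
  have [x Ux x0] := neq_set0 hU nU.
  have [y yx] := subm_incl_surj hU Ux; exists y => y0; apply: x0.
  by rewrite -yx y0 linear0.
have key (V : set (subm hU)) : submodule V -> V <> [set 0] ->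
    forall x, range i x -> exists2 y, V y & subm_incl hU y = x.
  move=> hV nV x ix; suff [y Vy yx] : (subm_incl hU @` V) x by exists y.
  apply: envelope_essential => //; first exact: submodule_image.
  move=> e; have [y Vy y0] := neq_set0 hV nV.
  have : (subm_incl hU @` V) (subm_incl hU y) by exists y.
  rewrite e => /= h; apply: y0; apply: (@subm_incl_inj _ _ _ hU).
  by rewrite linear0.
move=> V W hV hW nV nW VW.
have [x ix x0] := envelope_nonzero.
have [y Vy yx] := key V hV nV x ix; have [z Wz zx] := key W hW nW x ix.
have : (V `&` W) y.
  by split=> //; rewrite (_ : y = z) //; apply: (@subm_incl_inj _ _ _ hU); rewrite zx.
by rewrite VW => y0; apply: x0; rewrite -yx y0 linear0.
Qed.

(** Finitely generated submodules containing S are uniserial of bounded length.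
    One of maximal length is everything, since adding a further generator gives
    a module whose length is not larger. *)
Lemma envelope_fg (b : nat) :
  (forall (M : lmodType A) n F, @uniserial A M n F -> (n <= b)%N) ->
  finitely_generated I.
Proof.
move=> len; pose Q n := `[< exists (U : set I) (hU : submodule U) F,
  [/\ fg_sub U, range i `<=` U & @uniserial A (subm hU) n F] >].
have [z iz z0] := envelope_nonzero.
have nz (U : set I) : range i `<=` U -> U <> [set 0].
  by move=> iU U0; apply: z0; have := iU _ iz; rewrite U0.
have usub (U : set I) (hU : submodule U) : fg_sub U -> range i `<=` U ->
    exists n F, @uniserial A (subm hU) n F.
  move=> fU iU; have [n [F [_ uF]]] := nakayama_uniserial serialA
    (fg_sub_subm hU fU) (envelope_sub_indecomposable hU (nz U iU)).
  by exists n, F.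
have exQ : exists n, Q n.
  have hz := submodule_cyclic z.
  have iz' : range i `<=` cyclic_submod z.
    apply: envelope_essential => // e.
    by have := cyclic_submod_id z; rewrite e.
  have [n [F uF]] := usub _ hz (fg_sub_cyclic z) iz'.
  by exists n; apply/asboolP; exists (cyclic_submod z), hz, F; split=> //; apply: fg_sub_cyclic.
have Qb n : Q n -> (n <= b)%N by move=> /asboolP[U [hU [F [_ _ /len]]]].
have [n /asboolP[U [hU [F [fU iU uF]]]] nmax] := ex_maxnP exQ Qb.
apply/fg_subT; suff <- : U = setT by [].
apply/seteqP; split=> // x _.
pose V := submod_add U (cyclic_submod x).
have hx := submodule_cyclic x.
have hV : submodule V := submodule_add hU hx.
have fV : fg_sub V by apply: fg_sub_add => //; apply: fg_sub_cyclic.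
have UV : U `<=` V := submod_addl hx.
have iV : range i `<=` V by move=> y /iU /UV.
have [n' [F' uF']] := usub V hV fV iV.
have nn' : (n' <= n)%N by apply: nmax; apply/asboolP; exists V, hV, F'.
have [f fP] : exists f : {linear subm hU -> subm hV},
    forall y, subm_incl hV (f y) = subm_incl hU y.
  by apply: factor_inj; [exact: subm_incl_inj|rewrite !range_subm_incl].
have [j fj] := userial_all uF' (submodule_range f).
have le : (n <= n' - j)%N.
  apply: (userial_eq0 uF); rewrite -(userial_ker uF uF' fj) => y /= fy0.
  by apply: (@subm_incl_inj _ _ _ hU); rewrite -fP fy0 !linear0.
have n0 : (0 < n)%N.
  rewrite lt0n; apply/eqP => n0; apply: (nz U iU); apply/seteqP; split=> [y Uy|_ ->].
    by have [y' <-] := subm_incl_surj hU Uy; rewrite (userial_trivial uF n0 y') linear0.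
  exact: submod0.
have j0 : j = 0%N.
  have n'0 : (0 < n')%N by apply: leq_trans (leq_trans n0 le) (leq_subr _ _).
  move: (leq_trans nn' le); case: (posnP j) => // j0.
  by rewrite leqNgt ltn_subrL j0 n'0.
rewrite j0 (userial_top uF') in fj.
have [y <-] := subm_incl_surj hV (submod_addr hU (cyclic_submod_id x)).
have [w _ <-] : range f y by rewrite fj.
by rewrite fP; apply: subm_inclP.
Qed.

Lemma envelope_indecomposable : indecomposable I.
Proof.
have [x ix x0] := envelope_nonzero.
apply: uniform_indecomposable; first by exists x.
move=> U V hU hV nU nV UV; apply: x0.
have : (U `&` V) x by split; apply: envelope_essential ix.
by rewrite UV.
Qed.

Lemma envelope_socle n F : @uniserial A I n F -> (0 < n)%N -> range i = F n.-1.
Proof.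
move=> uF n0; have [x ix x0] := envelope_nonzero.
have hF := userial_sub uF n.-1.
have iF : range i `<=` F n.-1.
  apply: envelope_essential => // e.
  have := @userial_eq0 _ _ _ _ uF n.-1; rewrite e => /(_ (fun _ => id)).
  by rewrite leqNgt prednK ?leqnn.
have [j ej] := userial_all uF (submodule_range i).
apply/seteqP; split=> //; rewrite ej; apply: (userial_anti uF).
rewrite -ltnS prednK // ltnNge; apply/negP => nj.
by apply: x0; move: ix; rewrite ej (userial_bot uF).
Qed.

(** If P were longer, the quotient of P of length n + 1 would have I as its
    radical. The identity of I extends to this quotient, but a map defined on a
    uniserial module cannot send a proper submodule onto its whole nonzero
    image. *)
Lemma envelope_maximal (P Q : lmodType A) nQ G nP H n F
    (q : {linear Q -> P}) (f : {linear Q -> I}) :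
  @uniserial A Q nQ G -> @uniserial A P nP H -> @uniserial A I n F ->
  (0 < n)%N -> range q = H 1%N -> range f = setT -> (nP <= n)%N.
Proof.
move=> uG uH uF n0 qr fr; rewrite leqNgt; apply/negP => nnP.
have rf : range f = F 0%N by rewrite (userial_top uF).
have hH := userial_sub uH 1.
have [q' q'P] : exists q' : {linear Q -> subm hH},
    forall x, subm_incl hH (q' x) = q x.
  by apply: factor_inj; [exact: subm_incl_inj|rewrite range_subm_incl qr].
have q's : range q' = setT.
  apply/seteqP; split=> // y _.
  have [x _ xy] : range q (subm_incl hH y) by rewrite qr; apply: subm_inclP.
  by exists x => //; apply: (@subm_incl_inj _ _ _ hH); rewrite q'P.
have kk x : q' x = 0 -> f x = 0.
  move=> q0; have : [set x | q x = 0] x by rewrite /= -q'P q0 linear0.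
  rewrite (userial_ker uG uH qr) => Gx.
  have : G (n - 0)%N x by apply: (userial_anti uG) Gx; rewrite subn0 leq_subRL ?addn1 // (leq_ltn_trans _ nnP).
  by rewrite -(userial_ker uG uF rf).
have [g gP] := factor_surj q's kk.
have [injI _ _] := hI.
have [h hP] := injI _ _ _ g (@subm_incl_inj _ _ _ hH).
have hf x : h (q x) = f x by rewrite -q'P hP gP.
have hr : range h = F 0%N.
  rewrite -rf; apply/seteqP; split=> [y _|_ [x _ <-]].
    by rewrite rf (userial_top uF).
  by rewrite -hf; exists (q x).
have := userial_image uH uF hr 1; rewrite add0n => e.
apply: (userial_neqT uF n0 (ltn0Sn 0)); rewrite -e -qr.
apply/seteqP; split=> // y _; have [x _ <-] : range f y by rewrite fr.
by exists (q x); rewrite ?hf //; exists x.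
Qed.

End Envelope.

(** * Combinatorics of syzygies *)

Local Open Scope nat_scope.

(** The sequence x, y, p x, p y, p (p x), ... of end points of the successive
    syzygies of the interval [x, y). *)
Definition syz_end (p : nat -> nat) (x y m : nat) : nat :=
  iter m./2 p (if odd m then y else x).

Lemma syz_endSS p x y m : syz_end p x y m.+2 = p (syz_end p x y m).
Proof. by rewrite /syz_end /= negbK. Qed.

Section SyzygyEnds.
Variable p : nat -> nat.
Hypothesis p_mono : {homo p : i j / (i <= j)}.

Lemma iter_mono k : {homo iter k p : i j / (i <= j)}.
Proof. by elim: k => // k IH i j ij /=; apply/p_mono/IH. Qed.

Lemma syz_end_le x y m : (x <= y <= p x) -> (syz_end p x y m <= syz_end p x y m.+1).
Proof.
move=> /andP[xy yp]; rewrite /syz_end /= uphalf_half; case: (odd m) => /=.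
  by rewrite -iterS iterSr; apply: iter_mono.
exact: iter_mono.
Qed.

(** Take the least k for which one of the two equations holds, the first one if
    both do. By monotonicity an earlier coincidence in the corresponding
    sequence would force one of the equations for a smaller k, or the first one for k
    itself. *)
Lemma syz_end_parity z : (z < p 0) ->
  (exists k, iter k p z = iter k p z.+1 \/ iter k p z.+1 = iter k.+1 p 0) ->
  (exists n, [/\ ~~ odd n, syz_end p z z.+1 n = syz_end p z z.+1 n.+1 &
      forall m, (m < n) -> syz_end p z z.+1 m <> syz_end p z z.+1 m.+1]) \/
  (exists n, [/\ odd n, syz_end p 0 z.+1 n = syz_end p 0 z.+1 n.+1 &
      forall m, (m < n) -> syz_end p 0 z.+1 m <> syz_end p 0 z.+1 m.+1]).
Proof.
move=> zp [k0 k0P].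
have evenE x y j : syz_end p x y j.*2 = iter j p x by rewrite /syz_end doubleK odd_double.
have oddE x y j : syz_end p x y j.*2.+1 = iter j p y.
  by rewrite /syz_end /= uphalf_double odd_double.
pose Q k := (iter k p z == iter k p z.+1) || (iter k p z.+1 == iter k.+1 p 0).
have exQ : exists k, Q k.
  by exists k0; apply/orP; case: k0P => ->; [left|right].
have [k Qk kmin] := ex_minnP exQ.
have nQ j : (j < k) -> iter j p z <> iter j p z.+1 /\
    iter j p z.+1 <> iter j.+1 p 0.
  move=> jk; have : ~~ Q j by apply/negP => /kmin; rewrite leqNgt jk.
  by rewrite negb_or => /andP[/eqP ? /eqP ?].
have le1 j : (iter j p z.+1 <= iter j.+1 p 0) by rewrite iterSr; apply: iter_mono.
have half m : m = if odd m then m./2.*2.+1 else m./2.*2.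
  by rewrite -[LHS]odd_double_half; case: (odd m).
case: (eqVneq (iter k p z) (iter k p z.+1)) => [e|ne].
  left; exists k.*2; split; first by rewrite odd_double.
    by rewrite evenE oddE.
  move=> m; rewrite [m]half; case: (odd m); rewrite -?doubleS ?evenE ?oddE.
    move=> mk; have {}mk : (m./2 < k).
      by rewrite -ltn_double; apply: ltn_trans (ltnSn _) mk.
    move=> e'; have [_] := nQ _ mk; apply; apply/eqP; rewrite eqn_leq le1 e'.
    exact: iter_mono.
  by rewrite ltn_double => mk; have [] := nQ _ mk.
right; exists k.*2.+1; split; first by rewrite /= odd_double.
  rewrite -doubleS evenE oddE.
  by move: Qk; rewrite /Q (negbTE ne) /= => /eqP.
move=> m; rewrite [m]half; case: (odd m); rewrite -?doubleS ?evenE ?oddE.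
  by rewrite ltnS ltn_double => mk; have [] := nQ _ mk.
rewrite ltnS leq_double => mk e'.
have {}e' : iter m./2 p z = iter m./2 p z.+1.
  apply/eqP; rewrite eqn_leq -{2}e'; apply/andP; split; exact: iter_mono.
move: mk; rewrite leq_eqVlt => /orP[/eqP mk|mk]; last by have [] := nQ _ mk.
by move: ne; rewrite -mk e' eqxx.
Qed.

End SyzygyEnds.

Lemma pigeonhole (T : finType) (f : nat -> T) : exists i j, (i < j) /\ f i = f j.
Proof.
apply: contrapT => H.
suff : injective (fun i : 'I_#|T|.+1 => f i).
  by move=> /leq_card; rewrite card_ord ltnn.
move=> i j /= e; apply: val_inj => /=; apply: contrapT => /eqP; rewrite neq_ltn.
by case/orP=> h; apply: H; [exists i, j|exists j, i].
Qed.

(* Here T indexes the indecomposable projectives and None is the zero module, nx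
   gives the projective cover of the radical and c the length. *)
Section Orbit.
Variables (T : finType) (nx : option T -> option T) (c : option T -> nat).
Variables (o0 : option T) (z : nat).
Let s j := iter j nx o0.
Let p j := (j + c (s j)).
Hypothesis c0 : forall o, c o = 0 -> o = None.
Hypothesis cN : c None = 0.
Hypothesis c_nx : forall o, (c o <= (c (nx o)).+1).
Hypothesis nx_inj : forall o o', nx o = nx o' -> nx o <> None -> o = o'.
Hypothesis z_lt : (z < c o0).
Hypothesis c_o0 : forall o, nx o = o0 -> (c o <= z.+1).

(** The hypothesis c_nx says that the radical of a projective, of length
    c o - 1, is no longer than the next projective, which covers it. *)
Lemma end_mono : {homo p : i j / (i <= j)}.
Proof.
move=> i j /subnK <-; elim: (j - i) => // k /leq_trans; apply.
by rewrite /p addSn addSnnS leq_add2l -addn1 addn1; apply: c_nx.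
Qed.

Let iter_p_mono := iter_mono end_mono.

Let upper k : (iter k p z.+1 <= iter k.+1 p 0).
Proof. by rewrite iterSr; apply: iter_p_mono; rewrite /p add0n. Qed.

(** If L is the first index with s L = None, then p fixes L and moves every
    smaller index closer to L, so L steps take all of them to L. *)
Lemma orbit_terminates N : s N = None -> exists k, iter k p z = iter k p z.+1.
Proof.
move=> sN.
have exN : exists N, s N == None by exists N; rewrite sN.
have [L /eqP sL Lmin] := ex_minnP exN.
have pL : p L = L by rewrite /p sL cN addn0.
have plt j : (j < L) -> (j < p j).
  move=> jL; rewrite /p -[X in (X < _)]addn0 ltn_add2l lt0n; apply/eqP => /c0 sj.
  by have := Lmin j; rewrite sj eqxx leqNgt jL => /(_ isT).
have reach k j : (j <= L) -> (iter k p j <= L) /\ (minn L (j + k) <= iter k p j).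
  move=> jL; elim: k => [|k [h1 h2]] /=; first by rewrite addn0 geq_minr.
  split; first by rewrite -pL; apply: end_mono.
  move: h1; rewrite leq_eqVlt => /orP[/eqP ->|h1]; first by rewrite pL geq_minl.
  apply: leq_trans (plt _ h1); rewrite addnS.
  apply: leq_trans (_ : (minn L (j + k)).+1 <= _); last by [].
  by rewrite -minnSS leq_min (leq_trans (geq_minl _ _)) ?geq_minr.
have zL : (z < L).
  have p0 : (z < p 0) by rewrite /p add0n.
  by apply: (leq_trans p0); rewrite -pL; apply: end_mono.
have fin j : (j <= L) -> iter L p j = L.
  move=> jL; have [h1 h2] := reach L j jL; apply/eqP; rewrite eqn_leq h1 /=.
  by apply: leq_trans h2; rewrite leq_min leqnn leq_addl.
by exists L; rewrite !fin // ltnW.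
Qed.

(** A repetition in the string propagates back to its start by injectivity. *)
Lemma orbit_periodic : (forall N, s N <> None) ->
  exists2 n, (0 < n) & forall j, s (j + n) = s j.
Proof.
move=> sN; have [i [j [ij e]]] := pigeonhole s.
have {e} : s 0 = s (j - i).
  elim: i j ij e => [|i IH] [|j] // ij e.
  rewrite subSS; apply: IH => //; apply: nx_inj e _; exact: (sN i.+1).
move=> e; exists (j - i); first by rewrite subn_gt0.
by move=> k; rewrite /s iterD -[iter _ _ o0]/(s (j - i)) -e.
Qed.

(** In the periodic case pigeonhole makes p^k (z+1) congruent modulo n to some
    p^(k+1) v. Adding multiples of n to both makes them equal; whether v then
    lies beyond the translated starting point b * n or before it decides which
    equation holds. *)
Lemma orbit_meets :
  exists k, iter k p z = iter k p z.+1 \/ iter k p z.+1 = iter k.+1 p 0.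
Proof.
case: (pselect (exists N, s N = None)) => [[N /orbit_terminates[k e]]|sN].
  by exists k; left.
have [n n0 per] := orbit_periodic (fun N e => sN (ex_intro _ N e)).
have pper j a : p (j + a * n) = (p j + a * n).
  rewrite /p addnAC; congr (_ + _ + _); congr c.
  by elim: a => [|a IH]; rewrite ?addn0 // mulSn addnCA addnC per.
have iper k j a : iter k p (j + a * n) = (iter k p j + a * n).
  by elim: k => //= k ->.
have pz : (p n.-1 <= z + n).
  rewrite /p -[in X in (_ <= X)](prednK n0) -addSnnS addnC leq_add2r.
  apply: c_o0; rewrite -[nx _]/(s n.-1.+1) prednK //.
  exact: (per 0).
have [k [k' [kk']]] := pigeonhole (fun k => Ordinal (ltn_pmod (iter k p z.+1) n0)).
move=> /(congr1 val) /= e; exists k.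
pose v := iter (k' - k.+1) p z.+1.
have ev : iter k' p z.+1 = iter k.+1 p v by rewrite /v -iterD subnKC.
rewrite ev in e; set X := iter k p z.+1 in e *; set Y := iter k.+1 p v in e.
pose a := (X %/ n).+1; pose b := (Y %/ n).+1.
have eq : iter k.+1 p (v + a * n) = (X + b * n).
  rewrite iper -/Y {1}(divn_eq Y n) -e {2}(divn_eq X n) /a /b !mulSn.
  by rewrite ![(n + _)]addnC addnACA [RHS]addnACA; congr (_ + _); apply: addnC.
case: (leqP (b * n) (v + a * n)) => h.
  right; apply/eqP; rewrite eqn_leq upper /=.
  have := @iter_p_mono k.+1 _ _ h.
  have e0 := iper k.+1 0 b; rewrite add0n in e0.
  by rewrite eq e0 leq_add2r.
left; apply/eqP; rewrite eqn_leq iter_p_mono //=.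
have h' : (v + a * n <= n.-1 + (Y %/ n) * n).
  suff -> : n.-1 + Y %/ n * n = (b * n).-1 by rewrite -ltnS prednK ?muln_gt0.
  by rewrite /b mulSn; move: (Y %/ n * n) => q; case: (n) n0.
have le : (p (v + a * n) <= z + b * n).
  apply: leq_trans (end_mono h') _; rewrite pper /b mulSn addnA leq_add2r.
  exact: pz.
have := @iter_p_mono k _ _ le.
by rewrite iper -iterSr eq leq_add2r.
Qed.

End Orbit.

Local Open Scope ring_scope.

(** * Strings of projectives and their resolutions *)

Lemma zero_map (A : pzRingType) (M N : lmodType A) :
  exists f : {linear M -> N}, forall x, f x = 0.
Proof.
have l : linear (fun _ : M => 0 : N) by move=> a x y; rewrite scaler0 addr0.
pose f : {linear M -> N} := HB.pack (fun _ : M => 0 : N)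
  (GRing.isLinear.Build A M N *:%R _ l).
by exists f.
Qed.

Section String.
Variables (A : pzRingType) (T : finType) (e : T -> A).
Hypothesis ee : forall v, e v * e v = e v.

(** The zero idempotent at None lets a string end without a change of type. *)
Definition sproj (o : option T) : lmodType A := proj (oapp e 0 o).

Variables (c : option T -> nat) (F : forall o, nat -> set (sproj o)).
Hypothesis uF : forall o, uniserial (c o) (@F o).
Hypothesis cN : c None = 0%N.
Variable (s : nat -> option T).
Hypothesis s_step : forall j, exists f : {linear sproj (s j.+1) -> sproj (s j)},
  range f = @F (s j) 1%N.
Let p j := (j + c (s j))%N.

Lemma sproj_projective o : projective_module (sproj o).
Proof. by apply: proj_projective; case: o => [v|] /=; rewrite ?mulr0. Qed.

Lemma sproj_None (x : sproj None) : x = 0.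
Proof. exact: (userial_trivial (uF None) cN). Qed.

(** The length of the kernel of a map between uniserial modules is determined by
    its image, so any composite of the given maps serves as a differential. *)
Lemma string_map i j : (i <= j)%N ->
  exists f : {linear sproj (s j) -> sproj (s i)}, range f = @F (s i) (j - i)%N.
Proof.
elim: j => [|j IH]; rewrite leq_eqVlt => /orP[/eqP -> //|ij] //.
- by exists idfun; rewrite subnn (userial_top (uF _)) image_id.
- by exists idfun; rewrite subnn (userial_top (uF _)) image_id.
have [f fr] := IH ij; have [g gr] := s_step j.
exists (f \o g); rewrite subSn // -[(j - i).+1]addn1.
rewrite -(userial_image (uF _) (uF _) fr) -gr.
by apply/seteqP; split=> [_ [x _ <-]|_ [_ [x _ <-] <-]];
  [exists (g x) => //; exists x|exists x].
Qed.

(** The sequence Q_x <- Q_y <- Q_(p x) <- Q_(p y) <- ... is exact because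
    c_a - (b - a) = p a - b for a <= b <= p a. It is cut off where two end points
    agree, the map there having image zero, and it is minimal since the earlier
    images are proper submodules. *)
Lemma string_projdim (M : lmodType A) x y n (f : {linear sproj (s x) -> M}) :
  {homo p : i j / (i <= j)%N} -> (x <= y <= p x)%N -> range f = setT ->
  [set u | f u = 0] = @F (s x) (y - x)%N ->
  (forall m, (m <= n)%N -> syz_end p x y m <> syz_end p x y m.+1) ->
  syz_end p x y n.+1 = syz_end p x y n.+2 ->
  has_projdim M n.
Proof.
move=> p_mono xyp fr fk zlt zn.
set a := syz_end p x y in zlt zn.
have aS m : (a m <= a m.+1)%N by apply: syz_end_le.
pose t m := if (m <= n)%N then s (a m) else None.
have alt m : (m <= n)%N -> (a m < a m.+1)%N.
  by move=> mn; rewrite ltn_neqAle aS andbT; apply/eqP/zlt.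
have tn m : (m <= n)%N -> t m = s (a m) by rewrite /t => ->.
have tN m : (n < m)%N -> t m = None by rewrite /t ltnNge => /negbTE ->.
have aSS m : a m.+2 = (a m + c (s (a m)))%N by exact: syz_endSS.
have ac m : (a m.+1 <= a m + c (s (a m)))%N by rewrite -aSS.
have cpos m : (m <= n)%N -> (0 < c (s (a m)))%N.
  move=> mn; have := leq_trans (alt m mn) (ac m).
  by rewrite -[X in (X < _)%N]addn0 ltn_add2l.
have FN k : @F None k = [set 0] by rewrite (userial_bot (uF None)) // cN.
have dP m : exists d : {linear sproj (t m.+1) -> sproj (t m)},
    range d = @F (t m) (a m.+1 - a m)%N.
  case: (ltnP m n) => mn.
    by rewrite (tn m.+1 mn) (tn m (ltnW mn)); apply: string_map.
  have [d d0] := zero_map (sproj (t m.+1)) (sproj (t m)); exists d.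
  transitivity [set 0 : sproj (t m)].
    by apply/seteqP; split=> [_ [u _ <-] //|_ ->]; exists 0; rewrite ?d0.
  move: mn; rewrite leq_eqVlt => /orP[/eqP <-|mn]; last by rewrite (tN m mn) FN.
  rewrite (tn n (leqnn n)) (userial_bot (uF _)) // leq_subRL ?aS //.
  by rewrite zn aSS.
pose d m := projT1 (cid (dP m)).
have dr m : range (d m) = @F (t m) (a m.+1 - a m)%N := projT2 (cid (dP m)).
have exS m : range (d m.+1) = [set u | d m u = 0].
  rewrite dr (userial_ker (uF _) (uF _) (dr m)).
  case: (ltnP n m.+1) => mn; first by rewrite (tN _ mn) !FN.
  by rewrite (tn m (ltnW mn)) aSS subnBA ?aS // addnC.
pose P : projective_resolution M := @Build_projective_resolution A M
  (fun m => sproj (t m)) d f (fun m => @sproj_projective (t m)) fr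
  (eq_trans (dr 0%N) (esym fk)) exS.
have Plen : resolution_length_le P n.
  by move=> m mn; rewrite /res_mod /= (tN m mn); apply: sproj_None.
split; first by exists P.
move=> Q k Qk; rewrite leqNgt; apply/negP => kn.
have P0 : forall u : res_mod P n, u = 0.
  apply: (@minimal_resolution_zero A M P Q) (Qk n kn).
  - move=> m U hU cov; case: (ltnP n m) => mn.
      apply/seteqP; split=> // u _; rewrite (Plen m mn u); exact: submod0.
    apply: (userial_cover (uF (t m)) hU (submodule_range _) cov).
    rewrite dr; apply: (userial_neqT (uF (t m))); last by rewrite subn_gt0 alt.
    by rewrite (tn m mn) cpos.
  - by move=> m h; apply: (userial_surj_inj (uF (t m))).
have c0 : (0 < c (t n))%N by rewrite (tn n (leqnn n)) cpos.
have [u _] := userial_strict (uF (t n)) c0; apply.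
by rewrite (P0 u); apply: submod0; apply: (userial_sub (uF (t n))).
Qed.

End String.

(** * The theorem *)

Lemma zero_uniserial (A : pzRingType) (M : lmodType A) :
  (forall x : M, x = 0) -> uniserial 0 (fun=> [set 0 : M]).
Proof.
move=> M0; split=> //.
- by move=> _; apply: submodule_set0.
- by apply/seteqP; split=> // x _; apply: M0.
- by move=> _ x.
- move=> U hU; exists 0%N; apply/seteqP; split=> [x _|_ ->]; first exact: M0.
  exact: submod0.
Qed.

(** The vertices are a covering family of least size, nx picks a projective cover
    of each radical, and the string starts at a projective cover of I. *)
Lemma nakayama_odd_or_even (A : nzRingType) (S I : lmodType A) (i : {linear S -> I}) :
  (forall M : lmodType A, finitely_generated M -> indecomposable M -> serial M) ->
  artinian_module (A^o : lmodType A) ->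
  simple_module S -> injective_envelope i -> odd_module S \/ even_module I.
Proof.
move=> serialA artA hS hI.
have [m [e [eP cov irr]]] := basic_projectives artA.
have ee v : e v * e v = e v := (eP v).1.
have H (o : option 'I_m) : exists nF : nat * (nat -> set (sproj e o)),
    uniserial nF.1 nF.2 /\ (nF.1 = 0%N <-> o = None).
  case: o => [v|].
    have [n [F [n0 uF]]] := nakayama_uniserial serialA (proj_fg (ee v)) (eP v).2.
    by exists (n, F); split=> //; split=> //= n00; rewrite n00 in n0.
  exists (0%N, fun=> [set 0]); split=> //; apply: zero_uniserial => x.
  by apply: proj_val_inj; rewrite linear0 -(proj_valP x) /= mulr0.
pose c o := (projT1 (cid (H o))).1; pose F o := (projT1 (cid (H o))).2.
have uF o : uniserial (c o) (F o) := (projT2 (cid (H o))).1.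
have c0 o : c o = 0%N <-> o = None := (projT2 (cid (H o))).2.
have cN : c None = 0%N by apply/c0.
have nxP (o : option 'I_m) : exists o' : option 'I_m,
    (exists f : {linear sproj e o' -> sproj e o}, range f = F o 1%N) /\
    (o' = None <-> (c o <= 1)%N).
  case: (leqP (c o) 1) => co.
    exists None; split=> //; have [f f0] := zero_map (sproj e None) (sproj e o).
    exists f; rewrite (userial_bot (uF o) co).
    by apply/seteqP; split=> [_ [u _ <-] //|_ ->]; exists 0; rewrite ?f0.
  by have [v [f fr]] := cov _ _ _ (uF o) 1%N co; exists (Some v); split=> //; exists f.
have [nx nxP'] := choice nxP.
have nx_map o := (nxP' o).1; have nx_None o := (nxP' o).2.
have nx_inj o o' : nx o = nx o' -> nx o <> None -> o = o'.
  move=> eo no.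
  have co : (1 < c o)%N by rewrite ltnNge; apply/negP => /nx_None.
  have co' : (1 < c o')%N by rewrite ltnNge; apply/negP => /nx_None; rewrite -eo.
  have [f fr] := nx_map o; have [f' fr'] := nx_map o'; rewrite -eo in f' fr'.
  case: o eo no co f fr f' fr' => [v|]; last by rewrite cN.
  case: o' co' => [w|]; last by rewrite cN.
  move=> co' eo no co f fr f' fr'; congr Some.
  have [h hr] := common_radical_surj serialA (ee v) (uF (nx (Some v))) (uF (Some v))
    (uF (Some w)) (proj_fg (ee w)) co co' fr fr'.
  exact: irr hr.
have c_nx o : (c o <= (c (nx o)).+1)%N.
  by have [f fr] := nx_map o; apply: (userial_length (uF (nx o)) (uF o) fr).
have len (M : lmodType A) n G : @uniserial A M n G ->
    (n <= \sum_(v : 'I_m) c (Some v))%N.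
  move=> uG; case: (posnP n) => [->//|n0].
  have [v [f fr]] := cov M n G uG 0%N n0.
  have := userial_length (uF (Some v)) uG fr; rewrite add0n => /leq_trans; apply.
  by rewrite (bigD1 v) //= leq_addr.
have fgI := envelope_fg serialA hS hI len.
have iI := envelope_indecomposable hS hI.
have [n [G [n0 uG]]] := nakayama_uniserial serialA fgI iI.
have [v0 [f fr]] := cov _ _ _ uG 0%N n0.
pose z := n.-1; have zn : z.+1 = n by rewrite prednK.
pose s j := iter j nx (Some v0); pose p j := (j + c (s j))%N.
have s_step j : exists g : {linear sproj e (s j.+1) -> sproj e (s j)},
    range g = F (s j) 1%N := nx_map (s j).
have zc : (z < c (Some v0))%N.
  by rewrite zn; have := userial_length (uF (Some v0)) uG fr.
have c_o0 o : nx o = Some v0 -> (c o <= z.+1)%N.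
  move=> no; have [q qr] := nx_map o; rewrite no in q qr.
  have fT : range f = setT by rewrite fr (userial_top uG).
  by rewrite zn; apply: (envelope_maximal hI (uF (Some v0)) (uF o) uG n0 qr fT).
have p_mono : {homo p : a b / (a <= b)%N} := @end_mono _ nx c (Some v0) c_nx.
have p0 : (z < p 0)%N by rewrite /p add0n.
have meets := @orbit_meets _ nx c (Some v0) z (fun o => (c0 o).1) cN c_nx nx_inj zc c_o0.
case: (syz_end_parity p_mono p0 meets) => -[[|k] [kodd ke klt]] //.
- by have /eqP := ke; rewrite /syz_end /= eqn_leq ltnn andbF.
- left; split; first exact: simple_indecomposable.
  exists k; last by rewrite /= negbK in kodd.
  have [q qr] := string_map uF s_step (leq0n z).
  have fqr : range (f \o q) = G z.
    rewrite -[z in RHS]add0n -(userial_image (uF (Some v0)) uG fr) -[in RHS](subn0 z) -qr.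
    by apply/seteqP; split=> [_ [x _ <-]|_ [_ [x _ <-] <-]];
      [exists (q x) => //; exists x|exists x].
  have iG : range i = G z := envelope_socle hS hI uG n0.
  have [_ iinj _] := hI.
  have [g gP] : exists g : {linear sproj e (s z) -> S}, forall x, i (g x) = (f \o q) x.
    by apply: factor_inj => //; rewrite fqr iG.
  apply: (string_projdim ee uF cN s_step (f := g) p_mono _ _ _ _ ke) => //.
  + by rewrite leqnSn /= -/(p z) (leq_trans p0) // p_mono.
  + apply/seteqP; split=> // y _.
    have [x _ xy] : range (f \o q) (i y) by rewrite fqr -iG; exists y.
    by exists x => //; apply: iinj; rewrite gP.
  + rewrite subSnn -[1%N](subSnn z) zn -(userial_ker (uF (s z)) uG fqr).
    apply/seteqP; split=> x /= gx; first by rewrite -[f _]gP gx linear0.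
    by apply: iinj; rewrite gP /= gx linear0.
- right; split=> //; exists k; last by [].
  apply: (string_projdim ee uF cN s_step (x := 0%N)
    (f := f : {linear sproj e (s 0%N) -> I}) p_mono _ _ _ _ ke) => //.
  + by rewrite fr (userial_top uG).
  + by rewrite subn0 zn (userial_ker (uF (Some v0)) uG fr) subn0.
Qed.

Theorem theorem3p6 (R : comNzRingType) (A : algType R)
  (hA : nakayama_algebra A)
  (S IS : lmodType A) (i : {linear S -> IS})
  (hS : simple_module S) (hIS : injective_envelope i) :
  (odd_module S \/ even_module IS) /\
  (finite_projdim S \/ finite_projdim IS).
Proof.
have H : odd_module S \/ even_module IS.
  apply: nakayama_odd_or_even hS hIS; first by case: hA.
  by apply: artin_algebra_artinian; case: hA.
by split=> //; case: H => -[_ [d pd _]]; [left|right]; exists d.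
Qed.
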